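(* Let $d,n,t\in\mathbb{N}$ and let $Y\subseteq\mathbb{T}^d$ be an order $2$ digital $(t,n,d)$-net (in base $2$) of cardinality $N=2^n$. Let $X=\mathcal{R}Y=\{(|2y_1-1|,\dots,|2y_d-1|):(y_1,\dots,y_d)\in Y\}\subseteq[0,1]^d$ be the tent transformed point (multi)set, with $\#X=N$ counted with multiplicity. Then $$ e^{\mathrm{QMC}}(X,H^2_{\mathrm{mix}}([0,1]^d))\le C\,2^t N^{-2}(\log N)^{2d-1}, $$ where $C>0$ depends only on $d$.
   Context: $\mathbb{T}^d$ is identified with $[0,1)^d$. $H^2_{\mathrm{mix}}([0,1]^d)$ is the $d$-fold Hilbert tensor product of $H^2([0,1])=\{f\in L_2([0,1]):f''\in L_2([0,1])\}$ (weak derivative) with norm $\|f\|^2=\|f\|^2_{L_2}+\|f''\|^2_{L_2}$; equivalently the real functions $f$ on $[0,1]^d$ with $\big(\prod_{i\in e}\partial^2/\partial x_i^2\big)f\in L_2([0,1]^d)$ for all $e\subseteq\{1,\dots,d\}$, normed by the square root of the sum of the squared $L_2$-norms of these derivatives (any equivalent norm changes only the constant). For a finite multiset $X\subseteq[0,1]^d$ of $N$ points, $e^{\mathrm{QMC}}(X,H^2_{\mathrm{mix}}([0,1]^d))=\sup_{\|f\|\le1}\big|\frac1N\sum_{\mathbf{x}\in X}f(\mathbf{x})-\int_{[0,1]^d}f(\mathbf{x})\,d\mathbf{x}\big|$. Order $\alpha$ digital nets: let $C_1,\dots,C_d\in\{0,1\}^{\alpha n\times n}$ be matrices over the field $\mathbb{Z}/2\mathbb{Z}$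 with rows $c_{i,1}^\top,\dots,c_{i,\alpha n}^\top$. For $k=\kappa_0+2\kappa_1+\dots+2^{n-1}\kappa_{n-1}\in\{0,\dots,2^n-1\}$ with $\kappa=(\kappa_0,\dots,\kappa_{n-1})^\top$, compute $C_i\kappa=(\kappa^{(i)}_1,\dots,\kappa^{(i)}_{\alpha n})^\top$ over $\mathbb{Z}/2\mathbb{Z}$ and set $y^k_i=\sum_{\ell=1}^{\alpha n}\kappa^{(i)}_\ell 2^{-\ell}$; the digital net is $Y=\{\mathbf{y}^0,\dots,\mathbf{y}^{2^n-1}\}$. It is an order $\alpha$ digital $(t,n,d)$-net if for all choices of integers $0\le\nu_i\le n$ and indices $1\le j_{i,\nu_i}<\dots<j_{i,1}\le\alpha n$ ($i=1,\dots,d$) with $\sum_{i=1}^d\sum_{\ell=1}^{\min\{\alpha,\nu_i\}}j_{i,\ell}\le\alpha n-t$, the row vectors $c_{1,j_{1,\nu_1}},\dots,c_{1,j_{1,1}},\dots,c_{d,j_{d,\nu_d}},\dots,c_{d,j_{d,1}}\in\{0,1\}^n$ are linearly independent over $\mathbb{Z}/2\mathbb{Z}$. Here $\alpha=2$. *)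

(* Defs.v *)
From HB Require Import structures.
From mathcomp Require Import all_boot all_order all_algebra.
From mathcomp Require Import all_classical all_reals all_analysis.
Set Implicit Arguments. Unset Strict Implicit. Unset Printing Implicit Defensive.
Import Order.TTheory GRing.Theory Num.Theory.
Import numFieldNormedType.Exports.
Local Open Scope classical_set_scope.
Local Open Scope ring_scope.

(* Rows are indexed 0-based: row j : 'I_(2*n) is the paper's row j+1. *)
Definition top2 (m : nat) (S : {set 'I_m}) : {set 'I_m} :=
  [set j in S | #|[set k in S | j < k]| < 2]%N.

(* sum_{l <= min(2, nu)} j_l  (paper's 1-based indices) *)
Definition top2_weight (m : nat) (S : {set 'I_m}) : nat :=
  (\sum_(j in top2 S) j.+1)%N.

Definition order2_digital_net (d t n : nat)
    (C : 'I_d -> 'M['F_2]_(2 * n, n)) : Prop :=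
  forall S : 'I_d -> {set 'I_(2 * n)},
    (forall i, #|S i| <= n)%N ->
    (\sum_(i < d) top2_weight (S i) + t <= 2 * n)%N ->
    forall a : 'I_d -> 'I_(2 * n) -> 'F_2,
      \sum_(i < d) \sum_(j in S i) a i j *: row j (C i) = 0 ->
      forall i j, j \in S i -> a i j = 0.

Definition digits (n : nat) (k : nat) : 'cV['F_2]_n :=
  \col_(m < n) (odd (k %/ 2 ^ m))%:R.

Definition net_coord (R : realType) (d n : nat)
    (C : 'I_d -> 'M['F_2]_(2 * n, n)) (k : nat) (i : 'I_d) : R :=
  \sum_(l < 2 * n)
     (((C i *m digits n k) l ord0 != 0 : bool) : nat)%:R / (2 ^+ l.+1).

Definition tent_net_point (R : realType) (d n : nat)
    (C : 'I_d -> 'M['F_2]_(2 * n, n)) (k : 'I_(2 ^ n)) : 'rV[R]_d :=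
  \row_i `|2 * net_coord R C k i - 1|.

Definition set_coord (R : realType) (d : nat) (x : 'rV[R]_d) (i : 'I_d) (u : R)
  : 'rV[R]_d := \row_j (if j == i then u else x ord0 j).

Fixpoint iint_rec (R : realType) (d : nat) (s : seq 'I_d)
    (g : 'rV[R]_d -> \bar R) (x : 'rV[R]_d) : \bar R :=
  match s with
  | [::] => g x
  | i :: s' => (\int[lebesgue_measure]_(u in `[0%R, 1%R]) iint_rec s' g (set_coord x i u))%E
  end.

Definition cube_integral (R : realType) (d : nat) (g : 'rV[R]_d -> \bar R) : \bar R :=
  iint_rec (enum 'I_d) g 0.

Definition unit_cube (R : realType) (d : nat) : set 'rV[R]_d :=
  [set x | forall i, 0 <= x ord0 i <= 1].

Definition coord_vec (R : realType) (d : nat) (i : 'I_d) : 'rV[R]_d :=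
  delta_mx ord0 i.

Definition iter_partial (R : realType) (d : nat) (s : seq 'I_d)
    (phi : 'rV[R]_d -> R) : 'rV[R]_d -> R :=
  foldr (fun i h => 'D_(@coord_vec R d i) h) phi s.

(* C^infty with compact support in the open cube (0,1)^d *)
Definition test_function (R : realType) (d : nat) (phi : 'rV[R]_d -> R) : Prop :=
  (forall s : seq 'I_d, continuous (iter_partial s phi) /\
     forall (i : 'I_d) (x : 'rV[R]_d), derivable (iter_partial s phi) x (@coord_vec R d i))
  /\ exists2 delta : R, 0 < delta &
       forall x : 'rV[R]_d, (exists i, x ord0 i < delta \/ 1 - delta < x ord0 i) ->
         phi x = 0.

Definition mixed2 (R : realType) (d : nat) (e : {set 'I_d}) (phi : 'rV[R]_d -> R)
  : 'rV[R]_d -> R :=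
  iter_partial (flatten [seq [:: i; i] | i <- enum e]) phi.

Definition rv_of_tuple (R : realType) (d : nat) (x : d.-tuple R) : 'rV[R]_d :=
  \row_i tnth x i.

(* f is (the continuous representative of) an element of H^2_mix([0,1]^d)
   with norm <= 1: the weak derivatives g e = (prod_{i in e} d^2/dx_i^2) f
   exist in L_2 and sum_e ||g e||_2^2 <= 1. *)
Definition H2mix_unit_ball (R : realType) (d : nat) (f : 'rV[R]_d -> R) : Prop :=
  {within @unit_cube R d, continuous f} /\
  exists g : {set 'I_d} -> 'rV[R]_d -> R,
    (forall e, measurable_fun [set: d.-tuple R] (g e \o @rv_of_tuple R d)) /\
    (forall e phi, test_function phi ->
       cube_integral (fun x => (f x * mixed2 e phi x)%:E) =
       cube_integral (fun x => (g e x * phi x)%:E)) /\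
    (\sum_(e : {set 'I_d}) cube_integral (fun x => (g e x ^+ 2)%:E) <= 1)%E.

Definition eQMC (R : realType) (d N : nat) (P : 'I_N -> 'rV[R]_d) : \bar R :=
  ereal_sup [set `| ((N%:R)^-1 * \sum_(k < N) f (P k))%:E
                     - cube_integral (fun x => (f x)%:E) |%E
            | f in [set f | H2mix_unit_ball f]].

(* Main.v *)
Require Import Defs.
From HB Require Import structures.
From mathcomp Require Import all_boot all_order all_algebra.
From mathcomp Require Import all_classical all_reals all_analysis.
From mathcomp Require Import measurable_realfun.
From mathcomp Require Import zify ring lra.
Set Implicit Arguments. Unset Strict Implicit. Unset Printing Implicit Defensive.
Import Order.TTheory GRing.Theory Num.Theory.
Import numFieldNormedType.Exports.
Local Open Scope ring_scope.

(** For [f] in the unit ball and a finite signed point measure [sum_q a_q delta_(x_q)]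
    on the cube, the weak derivatives [g_E] are tested against smooth tensor products
    that approximate [prod_i ker (i \in E) (x_i, y_i)], where
    [ker true (x, y) = (y - x)_+ - (y - x) S(y)], [ker false (x, y) = ((y - x) S(y))'']
    and [S] is a smooth cutoff: the second derivatives of [(y - x)_+] are point masses,
    so summing over [E] gives [|sum_q a_q f(x_q)| <= 2^d sup |sum_q a_q prod_i ker|].
    This is applied to the tent transformed net minus a fine tent transformed dyadic
    grid, whose mean of [f] tends to the integral.

    As a function of [u], [ker (|2u - 1|, y)] is a combination of the constant and of
    functions [|2u - c|], whose Walsh coefficients are at most a constant times
    [2^-(a1 + a2)], with [a1 > a2] the two largest indices of the frequency: flipping
    these two digits takes a second difference, which vanishes away from the kink.
    The error of the net is the sum of the Walsh coefficients over the nonzero dual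
    frequencies. By the net property those have weight above [2n - t], and at most
    [2^(s./2 - (2n - t)./2)] of them share a given pair profile of total weight [s];
    as there are at most [(2n + 1)^(2d - 1)] profiles of weight [s], a geometric sum
    remains. *)

(** * Dual frequencies of an order 2 net *)

(** Test functions vanish near the boundary of the cube, but (y - x)_+ does not vanish at y = 1.
    Subtracting (y - x) S(y), with [S] equal to 0 near 0 and to 1 near 1, repairs this, and
    [ker false] puts back the second derivative so removed: in each coordinate the second derivative
    of [ker true] plus [ker false] is the point mass at [x]. Multiplying over the coordinates and
    expanding writes a point evaluation as a sum over [E], whose terms are exactly those that can be
    moved onto the weak derivative [g E]. Since the tent transform puts points on the boundary (the
    net point 0 goes to the corner with all coordinates 1), the mollified point masses are also
    shifted inwards, by at most twice their width [e].

    Comparing the net with a grid instead of the integral keeps everything finite: net coordinates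
    have [2 * n] binary digits, so their Walsh expansions are finite sums, inverted exactly, and no
    convergence has to be discussed. The bound obtained does not depend on the fineness of the grid,
    which is why the limit costs nothing. *)

Section RowWeights.
Variable m : nat.
Implicit Type r : 'rV['F_2]_m.

(* The 1-based indices of the last and of the last but one nonzero entry; 0 if there is none. *)
Definition hi1 r : nat := (\max_(j < m | r ord0 j != 0%R) j.+1)%N.
Definition hi2 r : nat :=
  (\max_(j < m | (r ord0 j != 0%R) && (j.+1 < hi1 r)) j.+1)%N.
Definition wt r : nat := (hi1 r + hi2 r)%N.

Lemma hi1_ge r j : r ord0 j != 0 -> (j < hi1 r)%N.
Proof. by move=> rj; rewrite /hi1 (bigD1 j) //= leq_maxl. Qed.

Lemma hi1_attained r : (0 < hi1 r)%N -> exists2 j, r ord0 j != 0 & j.+1 = hi1 r.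
Proof.
move=> h; have [j rj|nj] := pickP (fun j => r ord0 j != 0).
  have [k rk e] := eq_bigmax_cond (fun j : 'I_m => j.+1) (A := [pred j | r ord0 j != 0])
    (introT card_gt0P (ex_intro _ j rj)).
  by exists k => //; exact: esym e.
by move: h; rewrite /hi1 big_pred0.
Qed.

Lemma hi2_ge r j : r ord0 j != 0 -> j.+1 != hi1 r -> (j < hi2 r)%N.
Proof.
move=> rj nj; have lt : (j.+1 < hi1 r)%N by rewrite ltn_neqAle nj hi1_ge.
by rewrite /hi2 (bigD1 j) ?rj //= leq_maxl.
Qed.

Lemma hi2_attained r : (0 < hi2 r)%N ->
  exists2 j, r ord0 j != 0 & j.+1 = hi2 r /\ (hi2 r < hi1 r)%N.
Proof.
move=> h; have [j rj|nj] := pickP (fun j => (r ord0 j != 0) && (j.+1 < hi1 r)%N).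
  have [k /andP[rk lk] e] := eq_bigmax_cond (fun j : 'I_m => j.+1)
    (A := [pred j | (r ord0 j != 0) && (j.+1 < hi1 r)%N])
    (introT card_gt0P (ex_intro _ j rj)).
  by exists k => //; have -> : hi2 r = k.+1 by exact: e.
by move: h; rewrite /hi2 big_pred0.
Qed.

Lemma hi2_le_hi1 r : (hi2 r <= hi1 r)%N.
Proof. by apply/bigmax_leqP => j /andP[_ /ltnW]. Qed.

Lemma hi1_le r : (hi1 r <= m)%N.
Proof. by apply/bigmax_leqP => j _. Qed.

Lemma hi2_le r : (hi2 r <= m)%N.
Proof. exact: leq_trans (hi2_le_hi1 r) (hi1_le r). Qed.

Lemma wt_le_box r p : (forall j, r ord0 j != 0 -> (j < p)%N) -> (wt r <= p.*2)%N.
Proof.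
move=> h; rewrite /wt -addnn; apply: leq_add; apply/bigmax_leqP => j; first exact: h.
by move=> /andP[/h].
Qed.

Definition supp r : {set 'I_m} := [set j | r ord0 j != 0].

(** An index of the support other than [hi1 r] and [hi2 r] has both of them strictly above it, so it
    is not among the top two. *)
Lemma top2_weight_supp_le r : (top2_weight (supp r) <= wt r)%N.
Proof.
have sub j : j \in top2 (supp r) -> (j.+1 == hi1 r) || (j.+1 == hi2 r).
  rewrite !inE => /andP[rj cj]; case: eqP => //= /eqP n1.
  have h2 := hi2_ge rj n1; case: eqP => // /eqP n2.
  have lt2 : (j.+1 < hi2 r)%N by rewrite ltn_neqAle n2.
  have [k2 rk2 [e2 l21]] := hi2_attained (leq_trans (ltn0Sn _) lt2).
  have [k1 rk1 e1] := hi1_attained (leq_ltn_trans (leq0n _) l21).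
  have k12 : k1 != k2 by apply: contraTneq l21 => k12; rewrite -e1 -e2 k12 ltnn.
  suff : (2 <= #|[set k in supp r | (j < k)%N]|)%N by rewrite leqNgt cj.
  have <- : #|[set k1; k2]| = 2%N by rewrite cards2 k12.
  apply: subset_leq_card; apply/fintype.subsetP => k; rewrite !inE => /orP[]/eqP->.
    by rewrite rk1 -ltnS e1 (leq_trans lt2) // ltnW.
  by rewrite rk2 -ltnS e2.
have one c : (\sum_(j < m | j.+1 == c) j.+1 <= c)%N.
  have [j /eqP ej|nj] := pickP (fun j : 'I_m => j.+1 == c).
    rewrite (bigD1 j) ?ej //= big1 ?addn0 // => k /andP[/eqP ek].
    by rewrite -val_eqE /= -eqSS ek ej eqxx.
  by rewrite big_pred0.
rewrite /top2_weight /wt; apply: leq_trans (leq_add (one _) (one _)).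
rewrite [leqLHS]big_mkcond [X in (_ <= X + _)%N]big_mkcond.
rewrite [X in (_ <= _ + X)%N]big_mkcond -big_split /=.
apply: leq_sum => j _; case: ifP => [/sub/orP[]->//|//]; last exact: leq_addl.
exact: leq_addr.
Qed.

(** The support lies in the first [hi1 r] places and, apart from its last element, in the first
    [hi2 r]. A bound on the weight thus yields the cardinality bound that the net condition asks of
    each row set. *)
Lemma card_supp_le r : (#|supp r|.*2 <= (wt r).+1)%N.
Proof.
have lt_card p : (#|[set j : 'I_m | j < p]| <= p)%N.
  elim: p => [|p IH]; first by rewrite leqn0 cards_eq0; apply/eqP/setP => j; rewrite !inE.
  have [pm|mp] := ltnP p m; last first.
    by rewrite (leq_trans (max_card _))// card_ord (leq_trans mp).
  have -> : [set j : 'I_m | j < p.+1]%N = Ordinal pm |: [set j : 'I_m | j < p]%N.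
    by apply/setP => j; rewrite !inE -val_eqE /= ltnS leq_eqVlt.
  by rewrite cardsU1 addnC -addn1 leq_add // leq_b1.
have s1 : (#|supp r| <= hi1 r)%N.
  apply: leq_trans (lt_card _); apply: subset_leq_card; apply/fintype.subsetP => j.
  by rewrite !inE; apply: hi1_ge.
have s2 : (#|supp r| <= (hi2 r).+1)%N.
  have [h0|h0] := posnP (hi1 r); first by rewrite (leq_trans s1) // h0.
  have [k rk ek] := hi1_attained h0.
  have sub : supp r \subset k |: [set j : 'I_m | j < hi2 r]%N.
    apply/fintype.subsetP => j; rewrite !inE => rj; case: eqVneq => //= njk.
    by apply: hi2_ge => //; rewrite -ek eqSS val_eqE.
  by rewrite (leq_trans (subset_leq_card sub)) // cardsU1 -add1n leq_add // leq_b1.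
by rewrite -addnn /wt -addnS leq_add.
Qed.

End RowWeights.

Lemma F2_neq0 (x : 'F_2) : x != 0 -> x = 1.
Proof. by case: x => [[|[|//]]] i //= _; apply: val_inj. Qed.

(** * Counting dual frequencies with a given profile *)

Section DualNet.
Variables (d t n : nat) (C : 'I_d -> 'M['F_2]_(2 * n, n)).
Hypothesis n_gt0 : (0 < n)%N.
Hypothesis netC : order2_digital_net t C.

Notation freq := {ffun 'I_d -> 'rV['F_2]_(2 * n)}.
Definition dual (k : freq) : bool := \sum_i k i *m C i == 0.
Definition total_wt (k : freq) : nat := (\sum_i wt (k i))%N.

Lemma dualB k k' : dual k -> dual k' -> dual (k - k').
Proof.
rewrite /dual => /eqP e /eqP e'; apply/eqP.
transitivity (\sum_i k i *m C i - \sum_i k' i *m C i); last by rewrite e e' subrr.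
by rewrite -sumrB; apply: eq_bigr => i _; rewrite !ffunE mulmxBl.
Qed.

(** A dual frequency is a linear relation between the rows in its support. Were its weight small,
    the net property would make these rows independent and the frequency zero. *)
Lemma dual_wt_gt k : dual k -> k != 0 -> (2 * n < total_wt k + t)%N.
Proof.
move=> /eqP dk; apply: contraNT; rewrite -leqNgt => small.
have wt_i i : (wt (k i) <= total_wt k)%N by rewrite /total_wt (bigD1 i) //= leq_addr.
have card_i i : (#|supp (k i)| <= n)%N.
  have := card_supp_le (k i); have := wt_i i; move: small; lia.
have tot : (\sum_(i < d) top2_weight (supp (k i)) + t <= 2 * n)%N.
  apply: leq_trans small; rewrite leq_add2r; apply: leq_sum => i _.
  exact: top2_weight_supp_le.
have := netC card_i tot (a := fun i j => k i ord0 j).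
have -> : \sum_(i < d) \sum_(j in supp (k i)) k i ord0 j *: row j (C i) = 0.
  rewrite -[RHS]dk; apply: eq_bigr => i _; rewrite mulmx_sum_row [RHS](bigID (mem (supp (k i)))) /=.
  rewrite [X in _ = _ + X]big1 ?addr0 // => j; rewrite inE negbK => /eqP ->.
  by rewrite scale0r.
move=> /(_ erefl) h; apply/eqP/ffunP => i; rewrite ffunE; apply/rowP => j; rewrite mxE.
have [//|nz] := eqVneq (k i ord0 j) 0.
by apply: h; rewrite inE.
Qed.

Definition dual_box (p : 'I_d -> nat) : {set freq} :=
  [set k | dual k & [forall i, forall j, (k i ord0 j != 0) ==> (j < p i)%N]].

Lemma dual_boxP p k :
  reflect (dual k /\ forall i j, k i ord0 j != 0 -> (j < p i)%N) (k \in dual_box p).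
Proof.
rewrite inE; apply: (iffP andP) => -[dk h]; split=> //.
  by move=> i j; move/forallP: h => /(_ i) /forallP /(_ j) /implyP.
by apply/forallP => i; apply/forallP => j; apply/implyP => /h.
Qed.

(* Translation by a fixed element of [A]. *)
Lemma card_le_differences (A B : {set freq}) :
  (forall x y, x \in A -> y \in A -> x - y \in B) -> (#|A| <= #|B|)%N.
Proof.
move=> h; have [->|[x0 x0A]] := set_0Vmem A; first by rewrite cards0.
have inj : injective (fun x : freq => x - x0) by exact: addIr.
rewrite -(card_imset (mem A) inj); apply: subset_leq_card.
by apply/fintype.subsetP => _ /imsetP[x xA ->]; apply: h.
Qed.

(** Dropping one digit of the box passes to a subgroup of index at most two: frequencies in which
    this digit is nonzero agree there, so their differences lie in the smaller box. *)
Lemma card_dual_box_step p i : (0 < p i)%N ->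
  (#|dual_box p| <= 2 * #|dual_box (fun j => if j == i then (p i).-1 else p j)|)%N.
Proof.
move=> pi_gt0; set p' : 'I_d -> nat := fun j => if j == i then (p i).-1 else p j.
pose Z := [set k : freq | [exists j, (val j == (p i).-1) && (k i ord0 j != 0)]].
have boxp' k : dual k -> (forall i j, k i ord0 j != 0 -> (j < p i)%N) ->
    k \notin Z -> k \in dual_box p'.
  move=> dk bk; rewrite inE => /existsPn nZ; apply/dual_boxP; split=> // i1 j nz.
  rewrite /p'; case: eqP => [e|_]; last exact: bk.
  subst i1; have := nZ j; rewrite nz andbT /=; have := bk _ _ nz; move: pi_gt0.
  by case: (p i) => // pp _; rewrite ltnS /= leq_eqVlt => /orP[->|].
rewrite -(cardsID Z) [leqRHS]mul2n -addnn; apply: leq_add.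
  apply: card_le_differences => k k'; rewrite !finset.in_setI => /andP[/dual_boxP[dk bk]] Zk.
  move=> /andP[/dual_boxP[dk' bk']] Zk'; apply: boxp'; first exact: dualB.
    move=> i1 j; rewrite !ffunE !mxE; have [e|nz] := eqVneq (k i1 ord0 j) 0; last by move=> _; exact: bk.
    by rewrite e sub0r oppr_eq0; exact: bk'.
  move: Zk Zk'; rewrite !inE => /existsP[j /andP[/eqP ej nj]] /existsP[j' /andP[/eqP ej' nj']].
  apply/existsPn => j1; rewrite negb_and; case: eqVneq => //= e1; rewrite negbK.
  have E : j1 = j by apply: val_inj; rewrite /= e1 -ej.
  have E' : j1 = j' by apply: val_inj; rewrite /= e1 -ej'.
  by rewrite !ffunE !mxE {1}E E' (F2_neq0 nj) (F2_neq0 nj') subrr.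
by apply: subset_leq_card; apply/fintype.subsetP => k /finset.setDP[/dual_boxP[dk bk] nZ]; apply: boxp'.
Qed.

(** A box of total side [q] contains only the zero frequency, because weights in it are at most
    [2 * q], hence at most [2 * n - t]. Each further unit of side at most doubles the count. *)
Lemma card_dual_box q s p : (2 * q + t <= 2 * n)%N -> (\sum_i p i <= q + s)%N ->
  (#|dual_box p| <= 2 ^ s)%N.
Proof.
move=> qn; elim: s p => [|s IH] p sp.
  rewrite expn0 -[X in (_ <= X)%N](cards1 (0 : freq)); apply: subset_leq_card; apply/fintype.subsetP => k.
  move=> /dual_boxP[dk bk]; rewrite inE; apply/eqP/eqP; apply: contraT => nz.
  have := dual_wt_gt dk nz; rewrite ltnNge (leq_trans _ qn) // leq_add2r.
  rewrite addn0 in sp; apply: leq_trans (leq_mul (leqnn 2) sp).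
  by rewrite big_distrr /=; apply: leq_sum => i _; rewrite [leqRHS]mul2n; apply: wt_le_box; apply: bk.
have [le|gt] := leqP (\sum_i p i) (q + s).
  by rewrite (leq_trans (IH _ le)) // leq_exp2l.
have [i pi|np] := pickP (fun i => 0 < p i)%N; last first.
  move: gt; rewrite big1 ?ltn0 // => i _; apply/eqP; have := np i; lia.
apply: leq_trans (card_dual_box_step pi) _; rewrite expnS leq_mul2l /=.
apply: IH; rewrite -ltnS -addnS; apply: leq_trans sp.
rewrite (bigD1 i) //= eqxx [leqRHS](bigD1 i) //= -addSn prednK //.
by rewrite leq_add2l; apply: leq_sum => j /negbTE ->.
Qed.

(** Over [F_2], frequencies with equal profile agree from the second leading index on, so a
    difference lies in the box with sides [(v i).2.-1]. As the second index is at most the first,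
    these sides add up to at most half the total weight. *)
Lemma card_dual_profile (v : 'I_d -> nat * nat) q : (2 * q + t <= 2 * n)%N ->
  (#|[set k | dual k & [forall i, (hi1 (k i), hi2 (k i)) == v i]]|
     <= 2 ^ ((\sum_i ((v i).1 + (v i).2))./2 - q))%N.
Proof.
move=> qn; have [->|[k0]] := set_0Vmem [set k | dual k & [forall i, (hi1 (k i), hi2 (k i)) == v i]].
  by rewrite cards0.
rewrite inE => /andP[_ /forallP vk0].
have v21 i : ((v i).2 <= (v i).1)%N by rewrite -(eqP (vk0 i)) /= hi2_le_hi1.
have sumv : (\sum_i (v i).2.-1 <= (\sum_i ((v i).1 + (v i).2))./2)%N.
  rewrite geq_half_double -mul2n big_distrr /=; apply: leq_sum => i _; have := v21 i; lia.
apply: (@leq_trans #|dual_box (fun i => (v i).2.-1)|); last first.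
  by apply: (card_dual_box qn); rewrite (leq_trans sumv) // -maxnE leq_maxr.
apply: card_le_differences => k k'; rewrite !inE.
move=> /andP[dk /forallP vk] /andP[dk' /forallP vk']; apply/andP; split; first exact: dualB.
apply/forallP => i; apply/forallP => j; apply/implyP; rewrite !ffunE !mxE.
have [[e1 e2] [e1' e2']] := ((congr1 fst (eqP (vk i)), congr1 snd (eqP (vk i))),
  (congr1 fst (eqP (vk' i)), congr1 snd (eqP (vk' i)))); rewrite /= in e1 e2 e1' e2'.
suff key (a b : 'rV['F_2]_(2 * n)) : hi1 a = hi1 b -> hi2 a = hi2 b ->
    a ord0 j != 0 -> b ord0 j = 0 -> (j < (hi2 a).-1)%N.
  have [e|nz] := eqVneq (k i ord0 j) 0; have [e'|nz'] := eqVneq (k' i ord0 j) 0 => //.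
  - by rewrite e e' subrr eqxx.
  - by move=> _; rewrite -e2'; apply: (key (k' i) (k i)) => //; rewrite ?e1 ?e1' ?e2 ?e2'.
  - by move=> _; rewrite -e2; apply: (key (k i) (k' i)) => //; rewrite ?e1 ?e1' ?e2 ?e2'.
  - by rewrite (F2_neq0 nz) (F2_neq0 nz') subrr eqxx.
move=> h1 h2 aj bj.
have n1 : j.+1 != hi1 a.
  apply/eqP => ej; have /hi1_attained[l bl el] : (0 < hi1 b)%N by rewrite -h1 -ej.
  have lj : l = j by apply: val_inj; apply: succn_inj; rewrite el -h1 ej.
  by move: bl; rewrite lj bj eqxx.
have n2 : j.+1 != hi2 a.
  apply/eqP => ej; have /hi2_attained[l bl [el _]] : (0 < hi2 b)%N by rewrite -h2 -ej.
  have lj : l = j by apply: val_inj; apply: succn_inj; rewrite el -h2 ej.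
  by move: bl; rewrite lj bj eqxx.
have := hi2_ge aj n1; move: n2; lia.
Qed.

End DualNet.

(** * Summing the Walsh bound over the dual frequencies *)

Section ProfileSum.
Variable R : realType.

(** The value at [i0] is determined by the sum and the other values. This saves one factor and is
    the source of the exponent [2 * d - 1]. *)
Lemma card_ffun_sum_eq (I : finType) (i0 : I) (m s : nat) :
  (#|[set f : {ffun I -> 'I_m.+1} | (\sum_i f i)%N == s]| <= m.+1 ^ #|I|.-1)%N.
Proof.
pose phi (f : {ffun I -> 'I_m.+1}) := [ffun i => if i == i0 then ord0 else f i].
have inj : {in [set f : {ffun I -> 'I_m.+1} | (\sum_i f i)%N == s] &, injective phi}.
  move=> f g; rewrite !inE => /eqP sf /eqP sg /ffunP e.
  have eq i : i != i0 -> f i = g i by move=> ni; have := e i; rewrite !ffunE (negbTE ni).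
  apply/ffunP => i; have [->|/eq//] := eqVneq i i0; apply: val_inj => /=.
  move: sf; rewrite -sg (bigD1 i0) //= [RHS](bigD1 i0) //=.
  by rewrite (eq_bigr (fun i => val (g i))) => [/addIn//|j nj]; rewrite (eq j nj).
rewrite -(card_in_imset inj) -(cardC1 i0) -[X in (X ^ _)%N]card_ord.
rewrite -(card_pffun_on ord0 (mem (predC1 i0)) (mem predT)); apply: subset_leq_card.
apply/fintype.subsetP => _ /imsetP[f _ ->]; apply/pffun_onP; split=> //.
by apply/fintype.subsetP => i; rewrite !inE ffunE; have [//|] := eqVneq i i0; rewrite ?eqxx.
Qed.

(** Each exponent occurs at most twice, so the sum is at most twice a geometric series of ratio one
    half. *)
Lemma sum_half_uphalf_le M q :
  \sum_(i < M) (2^-1 : R) ^+ uphalf (q + i) <= 4 * 2^-1 ^+ uphalf q.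
Proof.
have pos k : 0 < (2^-1 : R) ^+ k by rewrite exprn_gt0 // invr_gt0.
elim: M {-2}M (leqnn M) q => [|M IH] [|[|N]] // le q.
- by rewrite big_ord0 mulr_ge0 // ltW.
- by rewrite big_ord0 mulr_ge0 // ltW.
- by rewrite big_ord1 addn0; have := pos (uphalf q); lra.
rewrite 2!big_ord_recl addn0 lift0 addn1.
rewrite (eq_bigr (fun i : 'I_N => (2^-1 : R) ^+ uphalf (q.+2 + i))); last first.
  by move=> i _; rewrite !lift0 !addnS.
have le1 : (2^-1 : R) ^+ uphalf q.+1 <= 2^-1 ^+ uphalf q.
  apply: ler_wiXn2l; [by rewrite invr_ge0 | by rewrite invf_le1 // ler1n |].
  by rewrite /= uphalf_half; case: (odd q).
have := IH N _ q.+2; rewrite ltnW // => /(_ isT); rewrite [uphalf q.+2]/= exprS.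
by have := pos (uphalf q); move: le1; lra.
Qed.

Variables (d t n : nat) (C : 'I_d -> 'M['F_2]_(2 * n, n)).
Hypotheses (d_gt0 : (0 < d)%N) (n_gt0 : (0 < n)%N) (t_le : (t <= 2 * n)%N).
Hypothesis netC : order2_digital_net t C.
Notation freq := {ffun 'I_d -> 'rV['F_2]_(2 * n)}.
Notation prof := {ffun ('I_d * bool) -> 'I_(2 * n).+1}.

Let profile (k : freq) : prof :=
  [ffun x => inord (if x.2 then hi1 (k x.1) else hi2 (k x.1))].

Let sum_pair (f : 'I_d * bool -> nat) :
  (\sum_x f x = \sum_i (f (i, true) + f (i, false)))%N.
Proof.
transitivity (\sum_i \sum_b f (i, b))%N; last by apply: eq_bigr => i _; rewrite big_bool.
by rewrite pair_bigA /=; apply: eq_bigr => -[].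
Qed.

Let profileE k x : profile k x = (if x.2 then hi1 (k x.1) else hi2 (k x.1)) :> nat.
Proof. by rewrite ffunE inordK // ltnS; case: x.2; rewrite ?hi1_le ?hi2_le. Qed.

Let sum_profile k : (\sum_x profile k x = total_wt k)%N.
Proof.
rewrite (eq_bigr (fun x : 'I_d * bool => if x.2 then hi1 (k x.1) else hi2 (k x.1))) => [|x _];
  last exact: profileE.
by rewrite sum_pair.
Qed.

Lemma dual_sum_le :
  \sum_(k : freq | dual C k && (k != 0)) (2^-1 : R) ^+ total_wt k
    <= 4 * 2 ^+ t * 2^-1 ^+ (2 * n) * (2 * n).+1%:R ^+ (2 * d - 1).
Proof.
have pos k : 0 < (2^-1 : R) ^+ k by rewrite exprn_gt0 // invr_gt0.
set q := (2 * n - t)%N.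
(* [G s] is 2^-s times the bound 2^(s./2 - q./2) on the number of frequencies with one profile of
   weight [s]; nonzero dual frequencies have weight above [q]. *)
pose G s : R := if (q < s)%N then 2^-1 ^+ uphalf s * 2^-1 ^+ q./2 else 0.
have G0 s : 0 <= G s by rewrite /G; case: ifP => // _; rewrite mulr_ge0 // ltW.
have inner (v : prof) :
    \sum_(k | (dual C k && (k != 0)) && (profile k == v)) (2^-1 : R) ^+ total_wt k
      <= G (\sum_x v x)%N.
  have [k0 /andP[/andP[dk0 nz0] /eqP pk0]|none] :=
    pickP (fun k => (dual C k && (k != 0)) && (profile k == v)); last first.
    have e0 : \sum_(k | (dual C k && (k != 0)) && (profile k == v)) (2^-1 : R) ^+ total_wt k = 0 by apply: big_pred0. by rewrite e0 G0.
  set s := (\sum_x v x)%N.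
  have qs : (q < s)%N.
    by rewrite /s -pk0 sum_profile; have := dual_wt_gt n_gt0 netC dk0 nz0; rewrite /q; lia.
  have cnt : (#|[pred k | (dual C k && (k != 0%R)) && (profile k == v)]| <= 2 ^ (s./2 - q./2))%N.
    pose w i := (v (i, true) : nat, v (i, false) : nat).
    have q2 : (2 * q./2 + t <= 2 * n)%N.
      by have := odd_double_half q; rewrite /q; case: (odd _) => /=; rewrite -mul2n; lia.
    have := card_dual_profile n_gt0 netC w q2.
    have -> : (\sum_i ((w i).1 + (w i).2) = s)%N by rewrite /s sum_pair.
    apply: leq_trans; apply: subset_leq_card; apply/fintype.subsetP => k.
    rewrite !inE => /andP[/andP[-> _] /eqP pk] /=; apply/forallP => i.
    by rewrite /w -pk !profileE.
  rewrite (eq_bigr (fun=> (2^-1 : R) ^+ s)) => [|k /andP[_ /eqP pk]]; last first.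
    by rewrite /s -pk sum_profile.
  rewrite sumr_const /G qs -[_ *+ _]mulr_natr.
  have le : (q./2 <= s./2)%N by rewrite half_leq // ltnW.
  have -> : (2^-1 : R) ^+ uphalf s * 2^-1 ^+ q./2 = 2^-1 ^+ s * 2 ^+ (s./2 - q./2).
    have e : ((s./2 - q./2) + (uphalf s + q./2) = s)%N.
      by have := odd_double_half s; rewrite uphalf_half -addnn; move: le; lia.
    have -> : (2^-1 : R) ^+ s = 2^-1 ^+ (s./2 - q./2) * 2^-1 ^+ (uphalf s + q./2).
      by rewrite -exprD e.
    by rewrite mulrAC -exprMn mulVf ?pnatr_eq0 // expr1n mul1r exprD.
  by rewrite ler_pM2l // -natrX ler_nat.
rewrite (partition_big profile xpredT) //=.
apply: (le_trans (ler_sum _ (fun v _ => inner v))).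
set M := (2 * d * (2 * n)).+1.
have vM (v : prof) : (\sum_x v x < M)%N.
  rewrite /M ltnS; apply: leq_trans (leq_sum _ (fun x _ => ltn_ord (v x) : (v x <= 2 * n)%N)) _.
  by rewrite sum_nat_const card_prod card_ord card_bool; lia.
rewrite (partition_big (fun v : prof => Ordinal (vM v)) xpredT) //=.
have cardI : #|{: 'I_d * bool}|.-1 = (2 * d - 1)%N by rewrite card_prod card_ord card_bool; lia.
apply: (@le_trans _ _ (\sum_(s < M) G s * (2 * n).+1%:R ^+ (2 * d - 1))).
  apply: ler_sum => s _.
  rewrite (eq_bigr (fun=> G s)) => [|v /eqP <- //].
  rewrite sumr_const -[_ *+ _]mulr_natr; apply: ler_wpM2l => //; rewrite -natrX ler_nat -cardI.
  apply: leq_trans (card_ffun_sum_eq (Ordinal d_gt0, true) (2 * n) s).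
  apply: subset_leq_card; apply/fintype.subsetP => v; rewrite unfold_in => /eqP <-.
  by rewrite inE.
rewrite -mulr_suml; apply: ler_wpM2r; first by rewrite exprn_ge0.
rewrite -(big_mkord xpredT G).
have -> : \sum_(0 <= s < M) G s = \sum_(0 <= s < M | (q < s)%N) (2^-1 : R) ^+ uphalf s * 2^-1 ^+ q./2.
  by rewrite [RHS]big_mkcond.
rewrite -[X in X <= _](@big_nat_widenl _ _ _ q.+1 0 M xpredT) //.
rewrite -mulr_suml -[X in \sum_(X <= _ < _) _]add0n big_addn big_mkord.
rewrite (eq_bigr (fun i : 'I_(M - q.+1) => (2^-1 : R) ^+ uphalf (q.+1 + i))) => [|i _]; last by rewrite addnC.
apply: (le_trans (ler_wpM2r (ltW (pos _)) (sum_half_uphalf_le _ _))).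
rewrite /= -!mulrA; apply: ler_wpM2l => //.
have -> : (2 : R) ^+ t * 2^-1 ^+ (2 * n) = 2^-1 ^+ q.
  have -> : (2 * n = t + q)%N by rewrite /q; lia.
  by rewrite exprD mulrA -exprMn divff ?pnatr_eq0 // expr1n mul1r.
(* The exponents add up to twice [q./2] plus one, which is at least [q] for either parity. *)
rewrite -exprD; apply: ler_wiXn2l; [by rewrite invr_ge0 | by rewrite invf_le1 // ler1n |].
by have := odd_double_half q; rewrite -addnn; case: (odd q); lia.
Qed.

End ProfileSum.

(** * Walsh coefficients of tent functions *)

Section Walsh.
Variable R : realType.

Definition sgn (x : 'F_2) : R := (-1) ^+ (x != 0).

Lemma sgn0 : sgn 0 = 1. Proof. by rewrite /sgn eqxx. Qed.
Lemma sgn1 : sgn 1 = -1. Proof. by rewrite /sgn oner_eq0. Qed.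

Lemma sgnD x y : sgn (x + y) = sgn x * sgn y.
Proof.
have [->|/F2_neq0->] := eqVneq x 0; first by rewrite add0r sgn0 mul1r.
have [->|/F2_neq0->] := eqVneq y 0; first by rewrite addr0 sgn0 mulr1.
have -> : (1 + 1 : 'F_2) = 0 by apply: val_inj.
by rewrite sgn0 sgn1 mulrNN mulr1.
Qed.

Lemma normr_sgn x : `|sgn x| = 1.
Proof. by rewrite /sgn normrX normrN1 expr1n. Qed.

Definition chi m (r : 'rV['F_2]_m) (b : 'cV['F_2]_m) : R := sgn ((r *m b) ord0 ord0).

Lemma chiD m (r : 'rV['F_2]_m) b c : chi r (b + c) = chi r b * chi r c.
Proof. by rewrite /chi mulmxDr mxE sgnD. Qed.

(** Adding the unit vector at a nonzero entry of [r] permutes the summands and flips every sign. *)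
Lemma sum_chi_col m (r : 'rV['F_2]_m) :
  \sum_b chi r b = if r == 0 then 2 ^+ m else 0.
Proof.
case: eqVneq => [->|nz].
  rewrite (eq_bigr (fun=> 1)) => [|b _]; last by rewrite /chi mul0mx mxE sgn0.
  by rewrite sumr_const card_mx muln1 card_Fp // natrX.
have [j rj] : exists j, r ord0 j != 0.
  apply/existsP; apply: contraNT nz => /existsPn h; apply/eqP/rowP => j; rewrite mxE.
  by apply/eqP; have := h j; rewrite negbK.
set S := \sum_b _; suff : S = - S by lra.
rewrite {1}/S (reindex (fun b : 'cV['F_2]_m => b + delta_mx j ord0)) /=; last first.
  by exists (fun b => b - delta_mx j ord0) => b _; rewrite ?addrK ?subrK.
rewrite /S -sumrN; apply: eq_bigr => b _.
have e : (r *m (delta_mx j ord0 : 'cV_m)) ord0 ord0 = 1.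
  rewrite mxE (bigD1 j) //= mxE !eqxx mulr1 big1 ?addr0 ?(F2_neq0 rj) // => k /negbTE nk.
  by rewrite mxE nk mulr0.
by rewrite chiD [chi r (delta_mx _ _)]/chi e sgn1 mulrN1.
Qed.

Lemma sum_chi_row m (b : 'cV['F_2]_m) :
  \sum_r chi r b = if b == 0 then 2 ^+ m else 0.
Proof.
have -> : \sum_r chi r b = \sum_c chi b^T c.
  rewrite (reindex (fun c : 'cV['F_2]_m => c^T)) /=; last first.
    by exists trmx => c _; rewrite trmxK.
  by apply: eq_bigr => c _; rewrite /chi -[c^T *m b]trmxK trmx_mul trmxK mxE.
rewrite sum_chi_col; congr (if _ then _ else _).
by apply/eqP/eqP => [e|->]; [rewrite -[b]trmxK e trmx0 | rewrite trmx0].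
Qed.

Definition dyadic m (b : 'cV['F_2]_m) : R :=
  \sum_(l < m) (((b l ord0 != 0) : bool) : nat)%:R / 2 ^+ l.+1.

(** Only the values at dyadic points with [m] digits enter: this is the finite transform on the
    grid, not an integral over [0, 1]. *)
Definition walsh m (h : R -> R) (r : 'rV['F_2]_m) : R :=
  2^-1 ^+ m * \sum_(b : 'cV['F_2]_m) h (dyadic b) * chi r b.

Definition dmean m (h : R -> R) : R :=
  2^-1 ^+ m * \sum_(b : 'cV['F_2]_m) h (dyadic b).

Lemma walsh0 m h : walsh h (0 : 'rV_m) = dmean m h.
Proof. by congr (_ * _); apply: eq_bigr => b _; rewrite /chi mul0mx mxE sgn0 mulr1. Qed.

Lemma half_pow_inv m : (2^-1 : R) ^+ m * 2 ^+ m = 1.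
Proof. by rewrite -exprMn mulVf ?pnatr_eq0 // expr1n. Qed.

Lemma F2_opp (x : 'F_2) : - x = x.
Proof. by have [->|/F2_neq0->] := eqVneq x 0; rewrite ?oppr0 //; apply: val_inj. Qed.

Lemma walsh_inversion m h (b : 'cV['F_2]_m) :
  h (dyadic b) = \sum_(r : 'rV['F_2]_m) walsh h r * chi r b.
Proof.
under eq_bigr do rewrite /walsh -mulrA.
rewrite -mulr_sumr; under eq_bigr do rewrite mulr_suml.
have inner (c : 'cV['F_2]_m) : \sum_(r : 'rV['F_2]_m) h (dyadic c) * chi r c * chi r b
    = if c == b then h (dyadic c) * 2 ^+ m else 0.
  under eq_bigr do rewrite -mulrA -chiD; rewrite -mulr_sumr sum_chi_row.
  have -> : (c + b == 0) = (c == b).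
    rewrite -[RHS]subr_eq0; congr (_ == 0); congr (c + _).
    by apply/colP => i; rewrite mxE F2_opp.
  by case: ifP; rewrite ?mulr0.
rewrite exchange_big /= (bigD1 b) //= inner eqxx big1 => [|c /negbTE nc]; last first.
  by rewrite inner nc.
by rewrite addr0 mulrCA half_pow_inv mulr1.
Qed.

Lemma walshD m h k (r : 'rV['F_2]_m) :
  walsh (fun u => h u + k u) r = walsh h r + walsh k r.
Proof.
rewrite /walsh -mulrDr -big_split /=; congr (_ * _).
by apply: eq_bigr => b _; rewrite mulrDl.
Qed.

Lemma walshZ m a h (r : 'rV['F_2]_m) : walsh (fun u => a * h u) r = a * walsh h r.
Proof.
rewrite /walsh [RHS]mulrCA; congr (_ * _); rewrite mulr_sumr.
by apply: eq_bigr => b _; rewrite mulrA.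
Qed.

Lemma walsh_cst m a (r : 'rV['F_2]_m) : walsh (fun=> a) r = if r == 0 then a else 0.
Proof.
rewrite /walsh -mulr_sumr sum_chi_col; case: ifP => _; rewrite ?mulr0 //.
by rewrite mulrCA half_pow_inv mulr1.
Qed.

Lemma sum_cV_recl m (G : 'cV['F_2]_(1 + m) -> R) :
  \sum_b G b = \sum_(b : 'cV['F_2]_m) (G (col_mx 0 b) + G (col_mx 1%:M b)).
Proof.
rewrite big_split /= (bigID (fun b : 'cV['F_2]_(1 + m) => usubmx b == 0)) /=; congr (_ + _).
  rewrite (reindex (fun b : 'cV['F_2]_m => col_mx 0 b)) /=.
    by apply: eq_big => [b|b _ //]; rewrite col_mxKu eqxx.
  exists dsubmx => [b _|b]; first by rewrite col_mxKd.
  by rewrite inE => /eqP e; rewrite -{2}[b]vsubmxK e.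
rewrite (reindex (fun b : 'cV['F_2]_m => col_mx 1%:M b)) /=.
  apply: eq_big => [b|b _ //]; rewrite col_mxKu.
  by apply/eqP => /matrixP /(_ ord0 ord0); rewrite !mxE eqxx => /eqP; rewrite oner_eq0.
exists dsubmx => [b _|b]; first by rewrite col_mxKd.
rewrite inE => nz; rewrite -{2}[b]vsubmxK; congr (col_mx _ _).
rewrite [RHS]mx11_scalar; congr (_%:M); rewrite -(@F2_neq0 (usubmx b ord0 ord0)) //.
apply: contraNneq nz => e; apply/eqP/matrixP => i j; rewrite !ord1 e mxE //.
Qed.

Lemma dyadic_col_mx m (x : 'F_2) (b : 'cV['F_2]_m) :
  dyadic (col_mx x%:M b : 'cV_(1 + m)) = ((x != 0 : bool)%:R + dyadic b) / 2.
Proof.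
rewrite /dyadic big_ord_recl mulrDl; congr (_ + _).
  have -> : (ord0 : 'I_(1 + m)) = lshift m ord0 by apply: val_inj.
  by rewrite col_mxEu mxE eqxx mulr1n expr1.
rewrite mulr_suml; apply: eq_bigr => i _.
have -> : lift ord0 i = rshift 1 i by apply: val_inj.
by rewrite col_mxEd /= /bump /= add1n exprS invfM mulrA mulrAC.
Qed.

Definition hd m (r : 'rV['F_2]_(1 + m)) : 'F_2 := r ord0 ord0.

Lemma chi_col_mx m (r : 'rV['F_2]_(1 + m)) (x : 'F_2) (b : 'cV['F_2]_m) :
  chi r (col_mx x%:M b) = sgn (hd r * x) * chi (rsubmx r) b.
Proof.
rewrite /chi -{1}[r]hsubmxK mul_row_col mxE sgnD; congr (sgn _ * _).
rewrite mul_mx_scalar !mxE mulrC; congr (_ * _); congr (r _ _); exact: val_inj.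
Qed.

Definition wabs m (r : 'rV['F_2]_m) (c : R) : R := walsh (fun u => `|2 * u - c|) r.

(** Writing u = (x + v) / 2 with leading digit [x] gives |2u - c| = |2v - (2c - 2x)| / 2, a function
    of the same family in [v]. The other factor one half comes from averaging over [x]. *)
Lemma wabs_rec m (r : 'rV['F_2]_(1 + m)) c :
  wabs r c = (wabs (rsubmx r) (2 * c) + sgn (hd r) * wabs (rsubmx r) (2 * c - 2)) / 4.
Proof.
rewrite /wabs /walsh sum_cV_recl big_split /= exprS.
have z : (0 : 'M['F_2]_1) = 0%:M by apply/matrixP => i j; rewrite !mxE mul0rn.
have e0 : \sum_(b : 'cV['F_2]_m) `|2 * dyadic (col_mx 0 b : 'cV_(1 + m)) - c| * chi r (col_mx 0 b)
   = 2^-1 * \sum_(b : 'cV['F_2]_m) `|2 * dyadic b - 2 * c| * chi (rsubmx r) b.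
  rewrite mulr_sumr; apply: eq_bigr => b _.
  rewrite z dyadic_col_mx chi_col_mx mulr0 sgn0 mul1r eqxx /= add0r [RHS]mulrA; congr (_ * _).
  have -> : 2 * (dyadic b / 2) - c = 2^-1 * (2 * dyadic b - 2 * c) by field.
  by rewrite normrM ger0_norm // invr_ge0.
have e1 : \sum_(b : 'cV['F_2]_m) `|2 * dyadic (col_mx 1%:M b : 'cV_(1 + m)) - c| * chi r (col_mx 1%:M b)
   = 2^-1 * sgn (hd r) * \sum_(b : 'cV['F_2]_m) `|2 * dyadic b - (2 * c - 2)| * chi (rsubmx r) b.
  rewrite mulr_sumr; apply: eq_bigr => b _.
  rewrite dyadic_col_mx chi_col_mx mulr1 oner_eq0 /=.
  have -> : 2 * ((1 + dyadic b) / 2) - c = 2^-1 * (2 * dyadic b - (2 * c - 2)) by field.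
  rewrite normrM [`|2^-1|]ger0_norm ?invr_ge0 //; ring.
rewrite e0 e1.
move: (\sum_b _) (\sum_b _) (2^-1 ^+ m) => X Y Z; by field.
Qed.

Lemma wabs_nil (r : 'rV['F_2]_0) c : wabs r c = `|c|.
Proof.
rewrite /wabs /walsh expr0 mul1r (eq_bigr (fun=> `|c|)) => [|b _].
  by rewrite sumr_const card_mx muln1 expn0.
by rewrite /dyadic big_ord0 /chi mulr0 sub0r normrN mxE big_ord0 sgn0 mulr1.
Qed.

End Walsh.

(** * Leading indices under prepending a digit *)

Section HiRec.
Variable m : nat.
Implicit Type r : 'rV['F_2]_m.

Lemma hi1_eq r v : (forall j, r ord0 j != 0 -> (j < v)%N) ->
  ((0 < v)%N -> exists2 j, r ord0 j != 0 & j.+1 = v) -> hi1 r = v.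
Proof.
move=> le at_; apply/eqP; rewrite eqn_leq; apply/andP; split.
  by apply/bigmax_leqP => j; apply: le.
by case: v at_ {le} => // v /(_ isT) [j rj <-]; apply: hi1_ge.
Qed.

Lemma hi2_eq r v : (forall j, r ord0 j != 0 -> j.+1 != hi1 r -> (j < v)%N) ->
  ((0 < v)%N -> exists2 j, r ord0 j != 0 & j.+1 = v /\ (v < hi1 r)%N) -> hi2 r = v.
Proof.
move=> le at_; apply/eqP; rewrite eqn_leq; apply/andP; split.
  by apply/bigmax_leqP => j /andP[rj lt]; apply: le => //; rewrite neq_ltn lt.
case: v at_ {le} => // v /(_ isT) [j rj [<- lt]]; apply: hi2_ge => //.
by rewrite neq_ltn lt.
Qed.

End HiRec.

Section HiCons.
Variables (m : nat) (r : 'rV['F_2]_(1 + m)).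
Let r' := rsubmx r.

Let rS (j : 'I_m) : r ord0 (rshift 1 j) = r' ord0 j.
Proof. by rewrite /r' mxE. Qed.

Let ordP (j : 'I_(1 + m)) : j = lshift m ord0 \/ exists k, j = rshift 1 k.
Proof. by case: (split_ordP j) => k ->; [left; rewrite (ord1 k)|right; exists k]. Qed.

Let r0 : r ord0 (lshift m ord0) = hd r.
Proof. by rewrite /hd; congr (r _ _); apply: val_inj. Qed.

Lemma hi1_rec : hi1 r = if (0 < hi1 r')%N then (hi1 r').+1 else (hd r != 0).
Proof.
apply: hi1_eq => [j|].
  case: (ordP j) => [->|[k ->]]; rewrite ?r0 ?rS => nz; last first.
    by have := hi1_ge nz; case: ifP => //= h; rewrite ?add1n ?ltnS //; move: h; case: (hi1 _).
  by case: ifP => //= _; rewrite nz.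
case: ifP => [h _|h].
  by have [j rj <-] := hi1_attained h; exists (rshift 1 j); rewrite ?rS //= add1n.
by case nz: (hd r != 0) => // _; exists (lshift m ord0); rewrite ?r0.
Qed.

Lemma hi2_rec : hi2 r = if (0 < hi2 r')%N then (hi2 r').+1
  else if (0 < hi1 r')%N then (hd r != 0) : nat else 0%N.
Proof.
apply: hi2_eq => [j|]; rewrite hi1_rec.
  case: (ordP j) => [->|[k ->]]; rewrite ?r0 ?rS => nz /=.
    by rewrite nz; case: ifP => // _; case: ifP.
  have h1 := hi1_ge nz; rewrite (leq_ltn_trans (leq0n _) h1) add1n eqSS => ne.
  by have := hi2_ge nz ne => h2; rewrite (leq_ltn_trans (leq0n _) h2) /= ltnS.
case: ifP => [h _|_].
  have [j rj [e lt]] := hi2_attained h; rewrite (leq_ltn_trans (leq0n _) lt).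
  by exists (rshift 1 j); rewrite ?rS //= add1n e; split.
case: ifP => // h; case nz: (hd r != 0) => // _; exists (lshift m ord0); rewrite ?r0 //=.
Qed.

End HiCons.

Section WalshBounds.
Variable R : realType.
Local Notation wabs := (@wabs R _).

Let pos k : 0 < (2^-1 : R) ^+ k.
Proof. by rewrite exprn_gt0 // invr_gt0. Qed.

(* Outside [0, 2] the kink of [u |-> |2u - c|] is not in [0, 1], so the function is affine
   there; the recursion on the leading digit maps [c] to [2c] and [2c - 2], of which at
   most one lies inside. *)
Lemma wabs_bound_all m (r : 'rV['F_2]_m) :
  (hi1 r = 0%N -> [/\ forall c, c <= 0 -> wabs r c = wabs r 0 - c,
     forall c, 2 <= c -> wabs r c = wabs r 2 + (c - 2),
     forall c c', `|wabs r c - wabs r c'| <= `|c - c'| &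
     forall c, `|wabs r c| <= 2 + `|c|]) /\
  ((0 < hi1 r)%N -> hi2 r = 0%N -> [/\ forall c, c <= 0 -> wabs r c = wabs r 0,
     forall c, 2 <= c -> wabs r c = wabs r 2 &
     forall c, `|wabs r c| <= 2^-1 ^+ hi1 r]) /\
  ((0 < hi2 r)%N -> [/\ forall c, c <= 0 -> wabs r c = 0,
     forall c, 2 <= c -> wabs r c = 0 &
     forall c, `|wabs r c| <= 2 * 2^-1 ^+ wt r]).
Proof.
elim: m r => [|m IH] r.
  have h1 : hi1 r = 0%N by rewrite /hi1 big_ord0.
  have h2 : hi2 r = 0%N by rewrite /hi2 big_ord0.
  rewrite h1 h2; split; last by split.
  move=> _; split=> [c c0|c c2|c c'|c]; rewrite !wabs_nil.
  - by rewrite normr0 ler0_norm // sub0r.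
  - by rewrite !ger0_norm //; lra.
  - exact: ler_dist_dist.
  - by rewrite normr_id; lra.
change 'rV['F_2]_(1 + m) in r; have rec := @wabs_rec R m r; move: (rsubmx r) (IH (rsubmx r)) (hi1_rec r) (hi2_rec r) rec.
move=> s [A [B D]] e1 e2 rec.
have tri (x y : R) : `|x + y| <= `|x| + `|y| := ler_normD x y.
have quarter (x y : R) : `|(x + y) / 4| <= (`|x| + `|y|) / 4.
  by rewrite normrM [`|4^-1|]ger0_norm ?invr_ge0 //; apply: ler_wpM2r; rewrite ?invr_ge0.
have quarterB (x y : R) : `|(x - y) / 4| <= (`|x| + `|y|) / 4.
  by rewrite -[`|y|]normrN; apply: quarter.
have [s2|s2] := posnP (hi2 s); last first.
  (* The tail has two nonzero digits: one of [2 * c] and [2 * c - 2] lies outside the open interval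
     (0, 2), where its coefficient is zero. The remaining factor 1/4 matches the increase of the
     weight by two. *)
  have s1 : (0 < hi1 s)%N := leq_trans s2 (hi2_le_hi1 s).
  have [D0 D2 Db] := D s2.
  rewrite s1 in e1; rewrite s2 in e2; rewrite e1 e2; split=> //; split=> // _.
  split=> [c c0|c c2|c]; rewrite rec.
  - by rewrite !D0 ?mulr0 ?addr0 ?mul0r //; lra.
  - by rewrite !D2 ?mulr0 ?addr0 ?mul0r //; lra.
  - have -> : (wt r = (wt s).+2)%N by rewrite /wt e1 e2 addSn addnS.
    have [c1|c1] := leP c 1.
      rewrite (D0 (2 * c - 2)) ?mulr0 ?addr0; last by lra.
      rewrite normrM [`|4^-1|]ger0_norm ?invr_ge0 // !exprS.
      by have := Db (2 * c); lra.
    rewrite (D2 (2 * c)) ?add0r; last by lra.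
    rewrite normrM [`|4^-1|]ger0_norm ?invr_ge0 // normrM normr_sgn mul1r !exprS.
    by have := Db (2 * c - 2); lra.
rewrite s2 /= in e2.
have [s1|s1] := posnP (hi1 s); last first.
  (* The tail has one nonzero digit. A leading digit one subtracts the two tail coefficients: the
     constants to the left of 0 and to the right of 2 cancel, and the factor 2 in the two-digit
     bound arises from adding their sizes. *)
  have [B0 B2 Bb] := B s1 s2; rewrite s1 in e1 e2.
  rewrite e1 e2; split=> //; case nz: (hd r != 0); split=> //.
    move=> _; rewrite (F2_neq0 nz) sgn1 in rec; split=> [c c0|c c2|c]; rewrite rec.
    - by rewrite (B0 (2 * c)) ?(B0 (2 * c - 2)); lra.
    - by rewrite (B2 (2 * c)) ?(B2 (2 * c - 2)); lra.
    - rewrite mulN1r; apply: le_trans (quarterB _ _) _.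
      have -> : (wt r = (hi1 s).+2)%N by rewrite /wt e1 e2 nz addn1.
      by rewrite !exprS; have := Bb (2 * c); have := Bb (2 * c - 2); lra.
  move=> _ _; move/eqP: nz => nz; rewrite nz sgn0 in rec; split=> [c c0|c c2|c]; rewrite !rec !mul1r.
  - by rewrite (B0 (2 * c)) ?(B0 (2 * c - 2)) ?(B0 (2 * 0 - 2)) ?mulr0; lra.
  - by rewrite (B2 (2 * c)) ?(B2 (2 * c - 2)) ?(B2 (2 * 2)) ?(B2 (2 * 2 - 2)); lra.
  - apply: le_trans (quarter _ _) _.
    by rewrite exprS; have := Bb (2 * c); have := Bb (2 * c - 2); lra.
have [A0 A2 Al Ab] := A s1; rewrite s1 /= in e1 e2; rewrite e1 e2.
case nz: (hd r != 0); split=> //; last first.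
  move=> _; move/eqP: nz => nz; rewrite nz sgn0 in rec; split=> [c c0|c c2|c c'|c]; rewrite !rec !mul1r.
  - by rewrite (A0 (2 * c)) ?(A0 (2 * c - 2)) ?(A0 (2 * 0 - 2)) ?mulr0; lra.
  - by rewrite (A2 (2 * c)) ?(A2 (2 * c - 2)) ?(A2 (2 * 2)) ?(A2 (2 * 2 - 2)); lra.
  - have -> : forall a b a' b' : R, (a + b) / 4 - (a' + b') / 4 = ((a - a') + (b - b')) / 4 by move=> *; ring.
    apply: le_trans (quarter _ _) _.
    have := Al (2 * c) (2 * c'); have := Al (2 * c - 2) (2 * c' - 2).
    have -> : 2 * c - 2 - (2 * c' - 2) = 2 * (c - c') by ring.
    have -> : 2 * c - 2 * c' = 2 * (c - c') by ring.
    by rewrite normrM [`|2|]ger0_norm //; lra.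
  - apply: le_trans (quarter _ _) _.
    have := Ab (2 * c); have := Ab (2 * c - 2); have := tri (2 * c) (-2).
    by rewrite normrM normrN !(@ger0_norm _ 2) //; lra.
(* Leading digit one over a zero tail: the Lipschitz bound between [2 * c] and [2 * c - 2] gives 2 /
   4, the bound for [hi1 r = 1]. *)
split=> // _ _; rewrite (F2_neq0 nz) sgn1 in rec; split=> [c c0|c c2|c]; rewrite !rec !mulN1r.
- by rewrite (A0 (2 * c)) ?(A0 (2 * c - 2)) ?(A0 (2 * 0 - 2)) ?mulr0; lra.
- by rewrite (A2 (2 * c)) ?(A2 (2 * c - 2)) ?(A2 (2 * 2)) ?(A2 (2 * 2 - 2)); lra.
- have := Al (2 * c) (2 * c - 2); have -> : 2 * c - (2 * c - 2) = 2 by ring.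
  by rewrite normrM [`|4^-1|]ger0_norm ?invr_ge0 // [`|2|]ger0_norm // expr1; lra.
Qed.

Lemma hi1_eq0 m (r : 'rV['F_2]_m) : hi1 r = 0%N -> r = 0.
Proof.
move=> h; apply/rowP => j; rewrite mxE; apply/eqP; apply: contraT => /hi1_ge.
by rewrite h.
Qed.

Lemma wt0 m : wt (0 : 'rV['F_2]_m) = 0%N.
Proof.
have h1 : hi1 (0 : 'rV['F_2]_m) = 0%N by apply: hi1_eq => // j; rewrite mxE eqxx.
by have := hi2_le_hi1 (0 : 'rV['F_2]_m); rewrite /wt h1 leqn0 => /eqP ->.
Qed.

Lemma wabs_le m (r : 'rV['F_2]_m) c : 0 <= c <= 2 -> `|wabs r c| <= 4 * 2^-1 ^+ wt r.
Proof.
move=> /andP[c0 c2]; have [A [B D]] := wabs_bound_all r.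
have [h2|/D[_ _ /(_ c)]] := posnP (hi2 r); last by have := pos (wt r); lra.
have [h1|h1] := posnP (hi1 r); last first.
  by have [_ _ /(_ c)] := B h1 h2; rewrite /wt h2 addn0; have := pos (hi1 r); lra.
(* For [r = 0] the bound 2 + |c| is at most 4 on [0, 2]; this case fixes the constant. *)
have [_ _ _ /(_ c)] := A h1; rewrite (hi1_eq0 h1) wt0 expr0 [`|c|]ger0_norm //; lra.
Qed.

Lemma wabs0_rec m c : wabs (0 : 'rV_m.+1) c
  = (wabs (0 : 'rV_m) (2 * c) + wabs (0 : 'rV_m) (2 * c - 2)) / 4.
Proof.
have -> : (0 : 'rV['F_2]_m) = rsubmx (0 : 'rV['F_2]_(1 + m)) by apply/rowP => j; rewrite !mxE.
by rewrite (@wabs_rec R m) /hd mxE sgn0 mul1r.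
Qed.

Lemma wabs0_succ m c : `|wabs (0 : 'rV_m.+1) c - wabs (0 : 'rV_m) c| <= 2^-1 ^+ m.+1.
Proof.
elim: m c => [|m IH] c.
  rewrite wabs0_rec !wabs_nil expr1.
  have -> : (`|2 * c| + `|2 * c - 2|) / 4 - `|c| = (`|c - 1| - `|c|) / 2.
    have -> : 2 * c - 2 = 2 * (c - 1) by ring.
    by rewrite !normrM !(@ger0_norm _ 2) //; field.
  have := ler_dist_dist (c - 1) c; have -> : c - 1 - c = -1 by ring.
  by rewrite normrN1 normrM [`|2^-1|]ger0_norm ?invr_ge0 //; lra.
rewrite [wabs (0 : 'rV_m.+2) c]wabs0_rec [wabs (0 : 'rV_m.+1) c]wabs0_rec.
have -> : forall a b a' b' : R, (a + b) / 4 - (a' + b') / 4 = ((a - a') + (b - b')) / 4 by move=> *; ring.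
rewrite normrM [`|4^-1|]ger0_norm ?invr_ge0 //.
have := ler_normD (wabs (0 : 'rV_m.+1) (2 * c) - wabs (0 : 'rV_m) (2 * c))
  (wabs (0 : 'rV_m.+1) (2 * c - 2) - wabs (0 : 'rV_m) (2 * c - 2)).
by have := IH (2 * c); have := IH (2 * c - 2); rewrite [_ ^+ m.+2]exprS; lra.
Qed.

(** At [r = 0] the coefficient is the grid mean, and its changes under refinement form a geometric
    series; the induction needs the sharper bound with the remaining tail subtracted. *)
Lemma wabs0_dist m k c : `|wabs (0 : 'rV_(k + m)) c - wabs (0 : 'rV_m) c| <= 2^-1 ^+ m.
Proof.
suff : `|wabs (0 : 'rV_(k + m)) c - wabs (0 : 'rV_m) c| <= 2^-1 ^+ m - 2^-1 ^+ (k + m).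
  by have := pos (k + m); lra.
elim: k => [|k IH]; first by rewrite !subrr normr0.
change (k.+1 + m)%N with (k + m).+1.
have := wabs0_succ (k + m) c; rewrite exprS => h.
have := ler_normD (wabs (0 : 'rV_(k + m).+1) c - wabs (0 : 'rV_(k + m)) c)
  (wabs (0 : 'rV_(k + m)) c - wabs (0 : 'rV_m) c).
by rewrite addrA subrK; lra.
Qed.

End WalshBounds.

(** * The mean over the net as a sum over dual frequencies *)

Section NetMean.
Variable R : realType.
Local Notation chi := (@chi R _).
Local Notation dyadic := (@dyadic R _).

Lemma sum_binary_digits n k : (k < 2 ^ n)%N ->
  (\sum_(m < n) odd (k %/ 2 ^ m) * 2 ^ m = k)%N.
Proof.
elim: n k => [|n IH] k; first by rewrite expn0 ltnS leqn0 => /eqP ->; rewrite big_ord0.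
move=> lt; rewrite big_ord_recl expn0 divn1 muln1 -[RHS]odd_double_half; congr (_ + _)%N.
have lt2 : (k./2 < 2 ^ n)%N by rewrite -divn2 ltn_divLR // mulnC -expnS.
rewrite -[in RHS](IH _ lt2) -muln2 big_distrl /=; apply: eq_bigr => i _.
by rewrite /bump leq0n add1n expnS divnMA divn2 [(2 * _)%N]mulnC mulnA.
Qed.

Lemma digits_bij n : bijective (fun k : 'I_(2 ^ n) => digits n k).
Proof.
apply: inj_card_bij; last by rewrite card_mx muln1 card_Fp // card_ord.
move=> k k' /colP e; apply: val_inj; rewrite /= -(sum_binary_digits (ltn_ord k)).
rewrite -[RHS](sum_binary_digits (ltn_ord k')); apply: eq_bigr => i _; congr (_ * _)%N.
by have := e i; rewrite !mxE; case: (odd _); case: (odd _).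
Qed.

Lemma dyadic_itv m (b : 'cV['F_2]_m) : 0 <= dyadic b <= 1.
Proof.
elim: m b => [|m IH] b; first by rewrite /dyadic big_ord0 lexx ler01.
change 'cV['F_2]_(1 + m) in b; rewrite -[b]vsubmxK [usubmx b]mx11_scalar dyadic_col_mx.
by have := IH (dsubmx b); case: (_ != 0) => /=; lra.
Qed.

Lemma chi_suml (I : finType) m (F : I -> 'rV['F_2]_m) (b : 'cV['F_2]_m) :
  chi (\sum_i F i) b = \prod_i chi (F i) b.
Proof.
apply: (big_morph (fun r => chi r b)) => [r s|]; last by rewrite /chi mul0mx mxE sgn0.
by rewrite /chi mulmxDl mxE sgnD.
Qed.

Variables (d n : nat) (C : 'I_d -> 'M['F_2]_(2 * n, n)).
Notation freq := {ffun 'I_d -> 'rV['F_2]_(2 * n)}.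

(** Expanding each factor leaves, for every [r], the sum over all digit vectors of the character of
    [\sum_i r i *m C i], which vanishes unless [r] is dual. *)
Lemma net_mean_walsh (h : 'I_d -> R -> R) :
  (2 ^ n)%:R^-1 * \sum_(k < 2 ^ n) \prod_i h i (net_coord R C k i)
    = \sum_(r : freq | dual C r) \prod_i walsh (h i) (r i).
Proof.
have expand (k : 'cV['F_2]_n) : \prod_i h i (dyadic (C i *m k))
    = \sum_(r : freq) (\prod_i walsh (h i) (r i)) * chi (\sum_i r i *m C i) k.
  under eq_bigr do rewrite (walsh_inversion (h _)).
  rewrite bigA_distr_bigA /=; apply: eq_bigr => r _; rewrite big_split /=; congr (_ * _).
  by rewrite chi_suml; apply: eq_bigr => i _; rewrite /chi mulmxA.
rewrite (eq_bigr (fun k : 'I_(2 ^ n) => \sum_(r : freq) (\prod_i walsh (h i) (r i)) *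
  chi (\sum_i r i *m C i) (digits n k))) => [|k _]; last by rewrite -expand.
rewrite exchange_big /= mulr_sumr [RHS]big_mkcond; apply: eq_bigr => r _ /=.
rewrite -mulr_sumr.
have -> : \sum_(k < 2 ^ n) chi (\sum_i r i *m C i) (digits n k) = \sum_b chi (\sum_i r i *m C i) b.
  by rewrite [RHS](reindex (fun k : 'I_(2 ^ n) => digits n k)) //; exact: onW_bij (digits_bij n).
rewrite sum_chi_col /dual; case: ifP => _; last by rewrite !mulr0.
by rewrite mulrC -mulrA natrX divff ?mulr1 // expf_neq0 // pnatr_eq0.
Qed.

(** The zero frequency contributes the product of the means over the grid of [2 * n] digits. *)
Lemma net_mean_dist (A : R) (h : 'I_d -> R -> R) :
  (forall i (r : 'rV['F_2]_(2 * n)), `|walsh (h i) r| <= A * 2^-1 ^+ wt r) ->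
  `|(2 ^ n)%:R^-1 * \sum_(k < 2 ^ n) \prod_i h i (net_coord R C k i)
     - \prod_i dmean (2 * n) (h i)|
    <= A ^+ d * \sum_(r : freq | dual C r && (r != 0)) 2^-1 ^+ total_wt r.
Proof.
move=> hA; rewrite net_mean_walsh (bigD1 (0 : freq)) /=; last first.
  by rewrite /dual big1 // => i _; rewrite ffunE mul0mx.
rewrite (eq_bigr (fun i => dmean (2 * n) (h i))) => [|i _]; last by rewrite ffunE walsh0.
rewrite addrC addrK mulr_sumr; apply: (le_trans (ler_norm_sum _ _ _)).
apply: ler_sum => r _; rewrite normr_prod.
have -> : A ^+ d * 2^-1 ^+ total_wt r = \prod_(i < d) (A * 2^-1 ^+ wt (r i)).
  by rewrite big_split /= prodr_const card_ord -expr_sum.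
by apply: ler_prod => i _; rewrite normr_ge0 hA.
Qed.

End NetMean.

(** * Net against grid for tent kernels *)

Section TentKernels.
Variable R : realType.

(** The shape of [u |-> ker b (tent u) y]: a constant and three functions |2u - c| with kink c/2 in
    [0, 1]. The bound [A] will be uniform in [y]. *)
Definition tent_kernel (A : R) (h : R -> R) : Prop :=
  exists (a : 'I_4 -> R) (c : 'I_3 -> R),
    [/\ forall j, `|a j| <= A, forall j, 0 <= c j <= 2 &
        h = fun u => a ord0 + \sum_j a (lift ord0 j) * `|2 * u - c j|].

Lemma half_pow_gt0 m : 0 < (2^-1 : R) ^+ m.
Proof. by rewrite exprn_gt0 // invr_gt0. Qed.

Lemma walsh_sum m (I : finType) (F : I -> R -> R) (r : 'rV['F_2]_m) :
  walsh (fun u => \sum_i F i u) r = \sum_i walsh (F i) r.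
Proof.
rewrite /walsh -mulr_sumr exchange_big /=; congr (_ * _).
by apply: eq_bigr => b _; rewrite mulr_suml.
Qed.

Lemma norm_sum3_le (F : 'I_3 -> R) e : (forall j, `|F j| <= e) -> `|\sum_j F j| <= 3 * e.
Proof.
move=> h; apply: (le_trans (ler_norm_sum _ _ _)); apply: (le_trans (ler_sum _ (fun j _ => h j))).
by rewrite sumr_const card_ord mulr_natl.
Qed.

Lemma walsh_tent_kernel m (a : 'I_4 -> R) (c : 'I_3 -> R) (r : 'rV['F_2]_m) :
  walsh (fun u => a ord0 + \sum_j a (lift ord0 j) * `|2 * u - c j|) r
    = (if r == 0 then a ord0 else 0) + \sum_j a (lift ord0 j) * wabs r (c j).
Proof.
rewrite walshD walsh_cst walsh_sum; congr (_ + _).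
by apply: eq_bigr => j _; rewrite walshZ.
Qed.

(** 13 = 1 + 3 * 4: the constant term, and three times the constant of [wabs_le]. *)
Lemma tent_kernel_walsh_le A h m (r : 'rV['F_2]_m) : tent_kernel A h ->
  `|walsh h r| <= 13 * A * 2^-1 ^+ wt r.
Proof.
move=> [a [c [ha hc ->]]]; rewrite walsh_tent_kernel.
have p := half_pow_gt0 (wt r).
have h0 : `|if r == 0 then a ord0 else 0| <= A * 2^-1 ^+ wt r.
  have A0 : 0 <= A := le_trans (normr_ge0 _) (ha ord0).
  by case: eqVneq => [->|_]; rewrite ?wt0 ?expr0 ?mulr1 // normr0 mulr_ge0 // ltW.
have hj j : `|a (lift ord0 j) * wabs r (c j)| <= A * (4 * 2^-1 ^+ wt r).
  by rewrite normrM ler_pM // wabs_le.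
apply: (le_trans (ler_normD _ _)).
by apply: (le_trans (lerD h0 (norm_sum3_le hj))); lra.
Qed.

Lemma tent_kernel_dmean_dist A h m k : tent_kernel A h ->
  `|dmean (k + m) h - dmean m h| <= 13 * A * 2^-1 ^+ m.
Proof.
move=> [a [c [ha hc ->]]]; rewrite -!walsh0 !walsh_tent_kernel !eqxx.
rewrite opprD addrACA subrr add0r -sumrB.
have p := half_pow_gt0 m; have A0 : 0 <= A := le_trans (normr_ge0 _) (ha ord0).
have hj j : `|a (lift ord0 j) * wabs (0 : 'rV['F_2]_(k + m)) (c j)
    - a (lift ord0 j) * wabs (0 : 'rV['F_2]_m) (c j)| <= A * 2^-1 ^+ m.
  by rewrite -mulrBr normrM ler_pM // wabs0_dist.
apply: (le_trans (norm_sum3_le hj)); rewrite -mulrA.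
by have := mulr_ge0 A0 (ltW p); lra.
Qed.

Lemma tent_kernel_bounded A h u : tent_kernel A h -> 0 <= u <= 1 -> `|h u| <= 13 * A.
Proof.
move=> [a [c [ha hc ->]]] hu; have A0 : 0 <= A := le_trans (normr_ge0 _) (ha ord0).
have hj j : `|a (lift ord0 j) * `|2 * u - c j| | <= A * 4.
  rewrite normrM ler_pM // normr_id ler_norml; have := hc j; lra.
apply: (le_trans (ler_normD _ _)).
by apply: (le_trans (lerD (ha _) (norm_sum3_le hj))); lra.
Qed.

(** The factors are exchanged one at a time. *)
Lemma prod_dist (I : finType) (a b : I -> R) (A e : R) : 0 <= e ->
  (forall i, `|a i| <= A) -> (forall i, `|b i| <= A) ->
  (forall i, `|a i - b i| <= A * e) ->
  `|\prod_i a i - \prod_i b i| <= #|I|%:R * A ^+ #|I| * e.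
Proof.
move=> e0 ha hb hab; rewrite cardT -!big_enum /=; elim: (enum I) => [|i s IH] /=.
  by rewrite !big_nil subrr normr0 !mul0r.
have A0 : 0 <= A := le_trans (normr_ge0 _) (ha i).
have pa : `|\prod_(j <- s) a j| <= A ^+ size s.
  elim: {IH} s => [|j s IH]; rewrite ?big_nil ?normr1 // big_cons normrM exprS.
  by rewrite ler_pM.
rewrite !big_cons.
have -> : a i * \prod_(j <- s) a j - b i * \prod_(j <- s) b j =
  (a i - b i) * \prod_(j <- s) a j + b i * (\prod_(j <- s) a j - \prod_(j <- s) b j) by ring.
apply: (le_trans (ler_normD _ _)); rewrite !normrM -natr1 exprS.
have h1 : `|a i - b i| * `|\prod_(j <- s) a j| <= A * e * A ^+ size s by rewrite ler_pM.
have h2 : `|b i| * `|\prod_(j <- s) a j - \prod_(j <- s) b j|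
   <= A * ((size s)%:R * A ^+ size s * e) by rewrite ler_pM.
by apply: (le_trans (lerD h1 h2)); rewrite le_eqVlt; apply/orP; left; apply/eqP; ring.
Qed.

Lemma dmean_bounded A h m : tent_kernel A h -> `|dmean m h| <= 13 * A.
Proof.
move=> hA; rewrite -walsh0; have := tent_kernel_walsh_le (0 : 'rV['F_2]_m) hA.
by rewrite wt0 expr0 mulr1.
Qed.

(** The grid of [2 * n] digits is the intermediate stage. The dual sum brings the net there, with
    constant 4; from there to [M] digits each of the [d] factors moves by at most 13 * A * 2^-(2n),
    which gives the [d]. *)
Lemma net_grid_dist (d t n M : nat) (C : 'I_d -> 'M['F_2]_(2 * n, n)) (A : R)
    (h : 'I_d -> R -> R) : (0 < d)%N -> (0 < n)%N -> order2_digital_net t C ->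
  (2 * n <= M)%N -> (forall i, tent_kernel A (h i)) ->
  `|(2 ^ n)%:R^-1 * \sum_(k < 2 ^ n) \prod_i h i (net_coord R C k i)
     - \prod_i dmean M (h i)|
    <= (d + 4)%:R * (13 * A) ^+ d * (2 ^+ t * 2^-1 ^+ (2 * n) * (2 * n).+1%:R ^+ (2 * d - 1)).
Proof.
move=> d0 n0 netC nM hA.
have A0 : 0 <= 13 * A.
  have [a [c [ha _ _]]] := hA (Ordinal d0).
  by have := le_trans (normr_ge0 _) (ha ord0); lra.
set L := (2 * n).+1%:R ^+ _; set B := (13 * A) ^+ d.
have B0 : 0 <= B by rewrite exprn_ge0.
have L1 : 1 <= L by rewrite exprn_ege1 // ler1n.
have p := half_pow_gt0 (2 * n).
have t1 : 1 <= (2 : R) ^+ t by rewrite exprn_ege1 // ler1n.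
have [tn|tn] := leqP t (2 * n).
  have e1 := net_mean_dist C (fun i r => tent_kernel_walsh_le r (hA i)).
  have e2 : `|\prod_(i < d) dmean (2 * n) (h i) - \prod_(i < d) dmean M (h i)|
      <= d%:R * B * 2^-1 ^+ (2 * n).
    have := @prod_dist 'I_d (fun i => dmean (2 * n) (h i)) (fun i => dmean M (h i))
      (13 * A) (2^-1 ^+ (2 * n)); rewrite card_ord; apply=> [|i|i|i].
    - exact: ltW.
    - exact: dmean_bounded.
    - exact: dmean_bounded.
    - by rewrite distrC -(subnK nM); apply: tent_kernel_dmean_dist.
  have e3 := dual_sum_le R d0 n0 tn netC.
  rewrite -(subrKA (\prod_i dmean (2 * n) (h i))); apply: (le_trans (ler_normD _ _)).
  apply: (le_trans (lerD (le_trans e1 (ler_wpM2l B0 e3)) e2)).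
  have -> : B * (4 * 2 ^+ t * 2^-1 ^+ (2 * n) * L) = 4 * B * (2 ^+ t * 2^-1 ^+ (2 * n) * L) by ring.
  set X := 2 ^+ t * _ * L; rewrite natrD.
  have -> : (d%:R + 4%:R) * B * X = d%:R * B * X + 4 * B * X by ring.
  rewrite addrC lerD2r; apply: ler_wpM2l.
    by rewrite mulr_ge0.
  have : 1 <= 2 ^+ t * L by rewrite -[X in X <= _]mulr1 ler_pM.
  by rewrite /X mulrAC => h1; have := ler_wpM2r (ltW p) h1; rewrite mul1r.
(* For [t] above [2 * n] the right-hand side is at least [(d + 4) * B], while both means are at most
   [B] in absolute value. *)
have hnet : `|(2 ^ n)%:R^-1 * \sum_(k < 2 ^ n) \prod_i h i (net_coord R C k i)| <= B.
  rewrite normrM ger0_norm ?invr_ge0 // mulrC ler_pdivrMr ?ltr0n ?expn_gt0 //.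
  apply: (le_trans (ler_norm_sum _ _ _)).
  have hk (k : 'I_(2 ^ n)) : `|\prod_i h i (net_coord R C k i)| <= B.
    rewrite normr_prod /B -[X in _ ^+ X]card_ord -prodr_const; apply: ler_prod => i _.
    by rewrite normr_ge0 tent_kernel_bounded // dyadic_itv.
  apply: (le_trans (ler_sum _ (fun k _ => hk k))).
  by rewrite sumr_const card_ord mulr_natr.
have hgrid : `|\prod_(i < d) dmean M (h i)| <= B.
  rewrite normr_prod /B -[X in _ ^+ X]card_ord -prodr_const; apply: ler_prod => i _.
  by rewrite normr_ge0 dmean_bounded.
have big : 1 <= 2 ^+ t * 2^-1 ^+ (2 * n) * L.
  rewrite -[X in X <= _]mulr1 ler_pM // -(subnK (ltnW tn)) exprD -mulrA -exprMn divff ?pnatr_eq0 //.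
  by rewrite expr1n mulr1 exprn_ege1 // ler1n.
apply: (le_trans (ler_normB _ _)); apply: (le_trans (lerD hnet hgrid)).
have : 2 * B <= (d + 4)%:R * B by rewrite ler_wpM2r // ler_nat; lia.
have dB : 0 <= (d + 4)%:R * B by rewrite mulr_ge0.
by have := ler_wpM2l dB big; rewrite mulr1; lra.
Qed.

End TentKernels.

(** * Smooth test functions *)

Section Smooth.
Variable R : realType.
Implicit Types (f g : R -> R) (x y : R).

(* All derivatives of [expR (- x^-1)] are combinations of the functions [flat k]. *)
Definition flat k x : R := if x <= 0 then 0 else x^-1 ^+ k * expR (- x^-1).

(** This is exp(y) >= y^(k+1) / (k+1)! at y = 1/x. *)
Lemma flat_norm_le k x : `|flat k x| <= (k.+1)`!%:R * `|x|.
Proof.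
rewrite /flat; case: (leP x 0) => [_|x0]; first by rewrite normr0 mulr_ge0.
have y0 : 0 < x^-1 by rewrite invr_gt0.
have := expR_ge1Dxn k (ltW y0).
rewrite normrM !ger0_norm ?expR_ge0 ?exprn_ge0 ?(ltW y0) ?(ltW x0) // => h.
have f0 : 0 < (k.+1)`!%:R :> R by rewrite ltr0n fact_gt0.
rewrite expRN ler_pdivrMr ?expR_gt0 //.
have {}h : x^-1 ^+ k.+1 / (k.+1)`!%:R <= expR x^-1 by lra.
rewrite ler_pdivrMr // in h.
have := ler_wpM2l (ltW x0) h; rewrite exprS mulrA divff ?gt_eqF // mul1r.
by move=> h2; rewrite mulrAC [_ * x]mulrC mulrA in h2 *; lra.
Qed.

Lemma flat_continuous_at0 k : {for 0, continuous (flat k)}.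
Proof.
have f0 : flat k 0 = 0 by rewrite /flat lexx.
apply/cvgrPdist_le => /= e e0; rewrite f0.
have c0 : 0 < (k.+1)`!%:R :> R by rewrite ltr0n fact_gt0.
near=> x; rewrite sub0r normrN; apply: le_trans (flat_norm_le _ _) _.
rewrite mulrC -ler_pdivlMr // ltW //; near: x.
have : \forall x \near (0 : R), `|0 - x| < e / (k.+1)`!%:R.
  by apply: (@cvgr_dist_lt _ _ _ (nbhs (0 : R)) _ id) => //; rewrite divr_gt0.
by apply: filterS => x; rewrite sub0r normrN.
Unshelve. all: by end_near. Qed.

Lemma flat_near_pos k x : 0 < x -> \forall z \near x, z^-1 ^+ k * expR (- z^-1) = flat k z.
Proof.
by move=> x0; near=> z; rewrite /flat leNgt ifN // negbK; near: z; exact: lt_nbhsr.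
Unshelve. all: by end_near. Qed.

Lemma is_derive_flat k x :
  is_derive x 1 (flat k) (flat k.+2 x - k%:R * flat k.+1 x).
Proof.
have [x0|x0|->] := ltgtP x 0.
- have -> : flat k.+2 x - k%:R * flat k.+1 x = 0 by rewrite /flat ltW // mulr0 subr0.
  apply: (near_eq_is_derive _ (is_derive_cst (0 : R) x (1 : R))).
  by near=> z; rewrite /flat ifT // ltW //; near: z; exact: lt_nbhsl.
- apply: (near_eq_is_derive (flat_near_pos k x0)).
  have xn0 : x != 0 by rewrite gt_eqF.
  have D1 : is_derive x 1 (fun y : R => y^-1) (- x ^- 2 *: 1).
    by apply: (is_deriveV (f := id)).
  have D2 : is_derive x 1 (expR \o - (fun y : R => y^-1)) (expR (- x^-1) * - (- x ^- 2 *: 1)).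
    exact: is_derive1_comp.
  have D3 := is_deriveM (is_deriveX k D1) D2.
  have -> : (fun z : R => z^-1 ^+ k * expR (- z^-1)) =
      (fun y : R => y^-1) ^+ k * (expR \o - (fun y : R => y^-1)).
    by apply/funext => z; rewrite !fctE.
  apply: (is_derive_eq D3).
  rewrite /flat leNgt x0 /= /GRing.scale /= !fctE.
  case: k D3 => [|k] _; last by rewrite -pred_Sn !exprS; field.
  by rewrite !expr0 !mul0r !mulr0 addr0 subr0 !mulr1 !mul1r opprK mulrC exprVn.
(* At 0 the difference quotient of [flat k] is [flat k.+1], which is continuous there. *)
- apply/is_derive1_caratheodory; exists (flat k.+1); split.
  + move=> z; rewrite /flat lexx !subr0; case: leP => z0; first by rewrite mul0r.
    by rewrite exprS; field; rewrite gt_eqF.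
  + exact: flat_continuous_at0.
  + by rewrite /flat lexx mulr0 subr0.
Unshelve. all: by end_near. Qed.

(** A syntactic class closed under differentiation: one derivative, found by induction on the
    construction, provides those of all orders. *)
Inductive smooth : (R -> R) -> Prop :=
| smooth_cst a : smooth (fun=> a)
| smooth_id : smooth (fun x => x)
| smooth_flat k : smooth (flat k)
| smoothD f g : smooth f -> smooth g -> smooth (fun x => f x + g x)
| smoothM f g : smooth f -> smooth g -> smooth (fun x => f x * g x)
| smoothV f : smooth f -> (forall x, f x != 0) -> smooth (fun x => (f x)^-1)
| smooth_affine a b f : smooth f -> smooth (fun x => f (a * x + b)).

Lemma smooth_is_derive f : smooth f ->
  exists2 f', smooth f' & forall x, is_derive x 1 f (f' x).
Proof.
elim=> {f} [a||k|f g _ [f' sf' df] _ [g' sg' dg]|f g sf [f' sf' df] sg [g' sg' dg]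
  |f sf [f' sf' df] nz|a b f _ [f' sf' df]].
- by exists (fun=> 0); [exact: smooth_cst|move=> x; exact: is_derive_cst].
- by exists (fun=> 1); [exact: smooth_cst|move=> x; exact: is_derive_id].
- exists (fun x => flat k.+2 x + (- k%:R) * flat k.+1 x).
    exact: smoothD (smooth_flat _) (smoothM (smooth_cst _) (smooth_flat _)).
  by move=> x; apply: is_derive_eq; [exact: is_derive_flat|rewrite mulNr].
- by exists (fun x => f' x + g' x); [exact: smoothD|move=> x; exact: is_deriveD].
- exists (fun x => f x * g' x + g x * f' x); first by apply: smoothD; apply: smoothM.
  by move=> x; exact: is_deriveM.
- exists (fun x => -1 * ((f x)^-1 * (f x)^-1) * f' x).
    apply: smoothM => //; apply: smoothM; first exact: smooth_cst.
    by apply: smoothM; apply: smoothV.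
  move=> x; apply: (is_derive_eq (is_deriveV (nz x) (df x))).
  by rewrite /GRing.scale /= mulN1r -invfM -expr2.
- exists (fun x => a * f' (a * x + b)); first by apply: smoothM; [exact: smooth_cst|exact: smooth_affine].
  move=> x; have D : is_derive x 1 (fun x : R => a * x + b) a.
    have Z : is_derive x 1 (fun x : R => a * x) a.
      have := @is_deriveZ _ _ _ (id : R -> R) a x 1 1 (is_derive_id _ _).
      by rewrite /GRing.scale /= mulr1.
    by have := is_deriveD Z (is_derive_cst b x (1 : R)); rewrite addr0.
  by rewrite mulrC; exact: is_derive1_comp.
Qed.

Lemma smooth_derivable f x : smooth f -> derivable f x 1.
Proof. by move=> /smooth_is_derive[f' _ /(_ x) []]. Qed.

Lemma smooth_derive1 f : smooth f -> smooth (derive1 f).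
Proof.
move=> /smooth_is_derive[f' sf' df]; suff -> : (derive1 f) = f' by [].
by apply/funext => x; rewrite derive1E; apply: derive_val.
Qed.

Lemma smooth_continuous f : smooth f -> continuous f.
Proof.
move=> sf x; apply: differentiable_continuous; apply/derivable1_diffP.
exact: smooth_derivable.
Qed.

Lemma smooth_is_derive1 f x : smooth f -> is_derive x 1 f ((derive1 f) x).
Proof. by move=> sf; rewrite derive1E; split => //; exact: smooth_derivable. Qed.

Lemma smoothB f g : smooth f -> smooth g -> smooth (fun x => f x - g x).
Proof.
move=> sf sg; have -> : (fun x => f x - g x) = (fun x => f x + (-1) * g x).
  by apply/funext => x; rewrite mulN1r.
by apply: smoothD => //; apply: smoothM => //; apply: smooth_cst.
Qed.

Lemma smoothZ a f : smooth f -> smooth (fun x => a * f x).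
Proof. by move=> sf; apply: smoothM => //; apply: smooth_cst. Qed.

Lemma smooth_subc c : smooth (fun x => x - c).
Proof. exact: smoothB smooth_id (smooth_cst _). Qed.

Lemma smooth_bounded f : smooth f -> exists A, forall x, 0 <= x <= 1 -> `|f x| <= A.
Proof.
move=> sf; have cf : {within `[0, 1], continuous (fun x => `|f x|)}%classic.
  apply: continuous_subspaceT => x; apply: continuous_comp; last exact: norm_continuous.
  exact: smooth_continuous.
have [c _ h] := EVT_max ler01 cf; exists `|f c| => x x01; apply: h.
by rewrite in_itv.
Qed.

Lemma derive1_near f g x : (\forall z \near x, f z = g z) -> (derive1 f) x = (derive1 g) x.
Proof. by move=> h; rewrite !derive1E; apply: near_eq_derive. Qed.

Lemma derive1_smoothD f g : smooth f -> smooth g ->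
  derive1 (fun x => f x + g x) = (fun x => (derive1 f) x + (derive1 g) x).
Proof.
move=> sf sg; apply/funext => x; rewrite derive1E; apply: derive_val.
by apply: is_deriveD; apply: smooth_is_derive1.
Qed.

Lemma derive1_smoothB f g : smooth f -> smooth g ->
  derive1 (fun x => f x - g x) = (fun x => (derive1 f) x - (derive1 g) x).
Proof.
move=> sf sg; apply/funext => x; rewrite derive1E; apply: derive_val.
by apply: is_deriveB; apply: smooth_is_derive1.
Qed.

Lemma derive1_smoothM f g : smooth f -> smooth g ->
  derive1 (fun x => f x * g x) = (fun x => f x * (derive1 g) x + g x * (derive1 f) x).
Proof.
move=> sf sg; apply/funext => x; rewrite derive1E; apply: derive_val.
by apply: is_deriveM; apply: smooth_is_derive1.
Qed.

Lemma derive1_subc c : derive1 (fun x : R => x - c) = fun=> 1.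
Proof.
apply/funext => x; rewrite derive1E; apply: derive_val.
have := @is_deriveB _ _ _ (id : R -> R) (cst c) x 1 1 0 (is_derive_id _ _) (is_derive_cst _ _ _).
by rewrite subr0.
Qed.

Lemma derive1_cst_fun a : derive1 (fun=> a : R) = fun=> (0 : R).
Proof. by apply/funext => x; rewrite derive1E; apply: derive_val. Qed.

Lemma derive1_rescale f c e : smooth f ->
  derive1 (fun x => f ((x - c) / e)) = fun x => e^-1 * (derive1 f) ((x - c) / e).
Proof.
move=> sf; apply/funext => x; rewrite derive1E; apply: derive_val.
have D : is_derive x 1 (fun x : R => (x - c) / e) e^-1.
  have -> : (fun x : R => (x - c) / e) = (fun x : R => x - c) * cst e^-1 by apply/funext.
  have := is_deriveM (smooth_is_derive1 x (smooth_subc c)) (is_derive_cst e^-1 x (1 : R)).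
  by rewrite derive1_subc /GRing.scale /= mulr0 add0r mulr1.
rewrite mulrC; apply: (@is_derive1_comp _ f (fun x : R => (x - c) / e)) => //.
exact: smooth_is_derive1.
Qed.

Lemma smooth_rescale f c e : smooth f -> smooth (fun x => f ((x - c) / e)).
Proof.
move=> sf; have -> : (fun x => f ((x - c) / e)) = (fun x => f (e^-1 * x + (- c / e))).
  by apply/funext => x; congr f; ring.
exact: smooth_affine.
Qed.

Definition step x : R := flat 0 x / (flat 0 x + flat 0 (1 - x)).

Lemma flat0_ge0 x : 0 <= flat 0 x.
Proof. by rewrite /flat; case: (leP x 0) => // _; rewrite expr0 mul1r expR_ge0. Qed.

Lemma flat0_gt0 x : 0 < x -> 0 < flat 0 x.
Proof. by move=> x0; rewrite /flat leNgt x0 /= expr0 mul1r expR_gt0. Qed.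

Lemma step_den_gt0 x : 0 < flat 0 x + flat 0 (1 - x).
Proof.
have [x0|x0] := ltP 0 x; first by rewrite ltr_pwDl ?flat0_gt0 ?flat0_ge0.
by rewrite ltr_wpDl ?flat0_ge0 // flat0_gt0 // subr_gt0; lra.
Qed.

Lemma smooth_step : smooth step.
Proof.
apply: smoothM; first exact: smooth_flat.
apply: smoothV => [|x]; last by rewrite gt_eqF // step_den_gt0.
apply: smoothD; first exact: smooth_flat.
have -> : (fun x => flat 0 (1 - x)) = (fun x => flat 0 (-1 * x + 1)).
  by apply/funext => x; congr flat; ring.
exact: smooth_affine (smooth_flat _).
Qed.

Lemma step0 x : x <= 0 -> step x = 0.
Proof. by move=> x0; rewrite /step {1}/flat x0 mul0r. Qed.

Lemma step1 x : 1 <= x -> step x = 1.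
Proof.
move=> x1; rewrite /step [flat 0 (1 - x)]/flat subr_le0 x1 addr0 divff // gt_eqF //.
by apply: flat0_gt0; apply: lt_le_trans x1.
Qed.

Lemma step_itv x : 0 <= step x <= 1.
Proof.
rewrite /step divr_ge0 ?flat0_ge0 ?(ltW (step_den_gt0 _)) //=.
by rewrite ler_pdivrMr ?step_den_gt0 // mul1r lerDl flat0_ge0.
Qed.

End Smooth.

(** * Finite sums of tensor products as test functions *)

Section Tensor.
Variables (R : realType) (d : nat).
Implicit Types (phi : 'I_d -> R -> R) (y : 'rV[R]_d).

Definition tsum N (a : 'I_N -> R) (phi : 'I_N -> 'I_d -> R -> R) y : R :=
  \sum_q a q * \prod_i phi q i (y ord0 i).

Definition dcoord (i : 'I_d) phi : 'I_d -> R -> R :=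
  fun j => if j == i then derive1 (phi j) else phi j.

Lemma is_derive_coord_line (f : 'rV[R]_d -> R) (c : R) (g : R -> R) (i : 'I_d) y :
  smooth g -> (forall h : R, f (h *: coord_vec R i + y) = c * g (h + y ord0 i)) ->
  is_derive y (coord_vec R i) f (c * derive1 g (y ord0 i)).
Proof.
move=> sg fE.
have fy : f y = c * g (y ord0 i) by have := fE 0; rewrite scale0r !add0r.
have [dg gE] := smooth_is_derive1 (y ord0 i) sg.
have lim_g : (h^-1 *: ((g \o shift (y ord0 i)) (h *: 1) - g (y ord0 i)) @[h --> 0^'] --> derive1 g (y ord0 i))%classic.
  by rewrite -gE; exact: dg.
have lim_f : (h^-1 *: ((f \o shift y) (h *: coord_vec R i) - f y) @[h --> 0^'] --> c * derive1 g (y ord0 i))%classic.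
  rewrite (_ : (fun h => _) = (fun h : R => c * (h^-1 *: ((g \o shift (y ord0 i)) (h *: 1) - g (y ord0 i))))).
    by apply: cvgM => //; exact: cvg_cst.
  by apply/funext => h /=; rewrite fE fy /GRing.scale /= mulr1; ring.
split; first by apply/cvg_ex; exists (c * derive1 g (y ord0 i)).
exact: cvg_lim.
Qed.

Lemma is_derive_tsum N (a : 'I_N -> R) (phi : 'I_N -> 'I_d -> R -> R) i y :
  (forall q i, smooth (phi q i)) ->
  is_derive y (coord_vec R i) (tsum a phi) (tsum a (fun q => dcoord i (phi q)) y).
Proof.
move=> sphi.
have -> : tsum a phi = \sum_(q < N) (fun y => a q * \prod_i phi q i (y ord0 i)).
  by apply/funext => z; rewrite fct_sumE.
apply: is_derive_sum => q.
rewrite (bigD1 i) //= {1}/dcoord eqxx.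
rewrite mulrCA [X in is_derive _ _ _ X]mulrC.
apply: is_derive_coord_line => // h; rewrite (bigD1 i) //= !mxE !eqxx mulr1 mulrCA mulrC.
congr (_ * _ * _); apply: eq_bigr => j nj.
by rewrite /dcoord (negbTE nj) !mxE (negbTE nj) mulr0 add0r.
Qed.

Lemma smooth_dcoord i phi : (forall j, smooth (phi j)) -> forall j, smooth (dcoord i phi j).
Proof. by move=> h j; rewrite /dcoord; case: eqP => // _; apply: smooth_derive1. Qed.

Lemma smooth_dcoords s phi : (forall j, smooth (phi j)) ->
  forall j, smooth (foldr dcoord phi s j).
Proof. by move=> h; elim: s => //= i s IH; apply: smooth_dcoord. Qed.

Lemma iter_partial_tsum N (a : 'I_N -> R) (phi : 'I_N -> 'I_d -> R -> R) s :
  (forall q i, smooth (phi q i)) ->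
  iter_partial s (tsum a phi) = tsum a (fun q => foldr dcoord (phi q) s).
Proof.
move=> sphi; elim: s => //= i s ->; apply/funext => y.
by apply: derive_val; apply: is_derive_tsum => q j; apply: smooth_dcoords.
Qed.

Lemma continuous_bigprod (I : Type) (s : seq I) (F : I -> 'rV[R]_d -> R) :
  (forall i, continuous (F i)) -> continuous (fun y => \prod_(i <- s) F i y).
Proof.
move=> cF; elim: s => [|i s IH] y.
  by under eq_fun do rewrite big_nil; exact: cst_continuous.
by under eq_fun do rewrite big_cons; apply: continuousM; [exact: cF|exact: IH].
Qed.

Lemma continuous_bigsum (I : Type) (s : seq I) (F : I -> 'rV[R]_d -> R) :
  (forall i, continuous (F i)) -> continuous (fun y => \sum_(i <- s) F i y).
Proof.
move=> cF; elim: s => [|i s IH] y.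
  by under eq_fun do rewrite big_nil; exact: cst_continuous.
by under eq_fun do rewrite big_cons; apply: continuousD; [exact: cF|exact: IH].
Qed.

Lemma continuous_tsum N (a : 'I_N -> R) (phi : 'I_N -> 'I_d -> R -> R) :
  (forall q i, continuous (phi q i)) -> continuous (tsum a phi).
Proof.
move=> cphi; apply: continuous_bigsum => q y; apply: continuousM; first exact: cst_continuous.
apply: continuous_bigprod => i z; apply: continuous_comp; first exact: coord_continuous.
exact: cphi.
Qed.

Lemma test_function_tsum N (a : 'I_N -> R) (phi : 'I_N -> 'I_d -> R -> R) (delta : R) :
  (forall q i, smooth (phi q i)) -> 0 < delta ->
  (forall q i u, u < delta \/ 1 - delta < u -> phi q i u = 0) ->
  test_function (tsum a phi).
Proof.
move=> sphi d0 supp0; split.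
  move=> s; rewrite iter_partial_tsum //; split.
    by apply: continuous_tsum => q i; apply: smooth_continuous; apply: smooth_dcoords.
  move=> i y; have := is_derive_tsum a i y (fun q i => smooth_dcoords s (sphi q) i).
  by case.
exists delta => // y [i hi]; rewrite /tsum big1 // => q _.
by rewrite (bigD1 i) //= supp0 // mul0r mulr0.
Qed.

Lemma dcoords_twice (s : seq 'I_d) phi j : uniq s ->
  foldr dcoord phi (flatten [seq [:: i; i] | i <- s]) j =
  if j \in s then derive1 (derive1 (phi j)) else phi j.
Proof.
elim: s => //= i s IH /andP[nis us]; rewrite in_cons /dcoord.
by case: (eqVneq j i) => [e|_] /=; rewrite IH //; rewrite e (negbTE nis).
Qed.

Lemma mixed2_tsum N (a : 'I_N -> R) (phi : 'I_N -> 'I_d -> R -> R) (e : {set 'I_d}) :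
  (forall q i, smooth (phi q i)) ->
  mixed2 e (tsum a phi)
    = tsum a (fun q i => if i \in e then derive1 (derive1 (phi q i)) else phi q i).
Proof.
move=> sphi; rewrite /mixed2 iter_partial_tsum //; apply/funext => y.
apply: eq_bigr => q _; congr (_ * _); apply: eq_bigr => i _.
by rewrite dcoords_twice ?enum_uniq // mem_enum.
Qed.

End Tensor.

(** * Iterated integrals over the cube *)

Section UniformlyContinuous.
Variables (R : realType) (d : nat).
Implicit Types (x y : 'rV[R]_d) (F G : 'rV[R]_d -> R) (h : R -> R).
Local Notation mu := (@lebesgue_measure R).
Local Notation cube := (@unit_cube R d).
Local Notation I01 := `[0%R : R, 1%R]%classic.
Local Notation cont01 h := ({within I01, continuous h}%classic).

(** Distances are measured coordinatewise, so that integrating out a coordinate preserves the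
    modulus with the same constants. *)
Definition modulus F (delta omega : R) : Prop :=
  forall x y, cube x -> cube y -> (forall i, `|x ord0 i - y ord0 i| <= delta) ->
    `|F x - F y| <= omega.

Definition ucont F : Prop := forall e, 0 < e -> exists2 delta, 0 < delta & modulus F delta e.

Lemma compact_cube : compact cube.
Proof.
have -> : cube = [set v : 'rV[R]_d | forall i, I01 (v ord0 i)]%classic.
  by apply/seteqP; split=> v /= h i; have := h i; rewrite /= in_itv.
by apply: (@rV_compact R d (fun=> I01)) => i; apply: segment_compact.
Qed.

(** The Heine-Cantor theorem, from near-covering compactness along [delta] tending to 0 from the
    right. Uniform continuity makes every partial integral continuous, hence integrable, with no
    appeal to Fubini. *)
Lemma within_continuous_ucont F : {within cube, continuous F}%classic -> ucont F.
Proof.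
move=> /subspace_continuousP cF e e0.
pose P (delta : R) x := cube x -> forall y, cube y ->
  (forall i, `|x ord0 i - y ord0 i| <= delta) -> `|F x - F y| <= e.
have := (compact_near_coveringP cube).1 compact_cube R ((0 : R)^'+)%classic P _.
case=> [x cx|].
  have e2 : 0 < e / 2 by rewrite divr_gt0.
  have /cvgrPdist_lt /(_ _ e2) := cF x cx.
  rewrite near_withinE => /nbhs_ballP[r /= r0 hr].
  have r2 : 0 < r / 2 by rewrite divr_gt0.
  exists (ball x (r / 2), [set t : R | t < r / 2])%classic => /=.
    split; first exact: nbhsx_ballx.
    by apply: nbhs_right_lt.
  move=> [x' t] /= [bx' tr] cx' y cy xy.
  (* [t] is only known to lie below [r / 2] and may be negative, so [x'] itself needs the second
     alternative. *)
  have far z : cube z -> (forall i, `|x' ord0 i - z ord0 i| <= t \/ x' = z) -> `|F x - F z| < e / 2.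
    move=> cz hz; apply: (hr z) => //; split=> // i j; rewrite (ord1 i).
    have := bx'.2 ord0 j; rewrite /ball /= => b1.
    have [hz'|<-] := hz j; last by apply: lt_trans b1 _; lra.
    rewrite (le_lt_trans (ler_distD (x' ord0 j) _ _)) // [ltRHS]splitr ltr_leD //.
    exact: le_trans hz' (ltW tr).
  have h1 := far x' cx' (fun i => or_intror erefl).
  have h2 := far y cy (fun i => or_introl (xy i)).
  by have := ler_distD (F x) (F x') (F y); rewrite [`|F x' - F x|]distrC; lra.
move=> r /= r0 hr; have r2 : 0 < r / 2 by rewrite divr_gt0.
exists (r / 2) => // x y cx cy xy; apply: (hr (r / 2)) => //=.
by rewrite sub0r normrN ger0_norm; lra.
Qed.

Lemma modulus01_cont h : (forall e, 0 < e -> exists2 delta, 0 < delta &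
    forall u v, 0 <= u <= 1 -> 0 <= v <= 1 -> `|u - v| <= delta -> `|h u - h v| <= e) ->
  cont01 h.
Proof.
move=> hu; apply/subspace_continuousP => u /=; rewrite in_itv /= => u01.
apply/cvgrPdist_le => e e0; have [delta d0 hd] := hu e e0.
rewrite near_withinE; apply/nbhs_ballP; exists delta => //= v; rewrite /ball /= => uv.
by rewrite in_itv /= => v01; apply: hd => //; exact: ltW.
Qed.

Lemma cube_set_coord x i u : cube x -> 0 <= u <= 1 -> cube (set_coord x i u).
Proof. by move=> cx u01 j; rewrite mxE; case: eqP. Qed.

Lemma cube0 : cube 0.
Proof. by move=> i; rewrite mxE lexx ler01. Qed.

Lemma ucont_slice F x i : ucont F -> cube x -> cont01 (fun u => F (set_coord x i u)).
Proof.
move=> uF cx; apply: modulus01_cont => e e0; have [delta d0 hd] := uF e e0.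
exists delta => // u v u01 v01 uv; apply: hd; try exact: cube_set_coord.
by move=> j; rewrite !mxE; case: eqP => // _; rewrite subrr normr0 ltW.
Qed.

Lemma cont01_integrable h : cont01 h -> mu.-integrable I01 (EFin \o h).
Proof. by move=> ch; apply: continuous_compact_integrable => //; exact: segment_compact. Qed.

Definition int01 h : R := (\int[mu]_(u in I01) h u)%R.

Lemma mu01 : mu I01 = 1%E.
Proof. by rewrite lebesgue_measure_itv /= lte_fin ltr01 oppr0 adde0. Qed.

Lemma EFin_int01 h : cont01 h -> (\int[mu]_(u in I01) (h u)%:E)%E = (int01 h)%:E.
Proof.
by move=> ch; rewrite /int01 /Rintegral fineK //; apply: integrable_fin_num => //; exact: cont01_integrable.
Qed.

Lemma int01_cst a : int01 (fun=> a) = a.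
Proof. by rewrite /int01 Rintegral_cst //= mu01 /= mulr1. Qed.

Lemma eq_int01 h g : (forall u, 0 <= u <= 1 -> h u = g u) -> int01 h = int01 g.
Proof. by move=> e; apply: eq_Rintegral => u; rewrite inE /= in_itv /= => /e. Qed.

Lemma cont01_cst a : cont01 (fun=> a : R).
Proof. by apply: continuous_subspaceT => u; exact: cst_continuous. Qed.

Lemma cont01B h g : cont01 h -> cont01 g -> cont01 (fun u => h u - g u).
Proof. by move=> ch cg u; apply: continuousB; [exact: ch|exact: cg]. Qed.

Lemma cont01M h g : cont01 h -> cont01 g -> cont01 (fun u => h u * g u).
Proof. by move=> ch cg u; apply: continuousM; [exact: ch|exact: cg]. Qed.

Lemma int01D h g : cont01 h -> cont01 g -> int01 (fun u => h u + g u) = int01 h + int01 g.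
Proof. by move=> ch cg; apply: RintegralD => //; exact: cont01_integrable. Qed.

Lemma int01B h g : cont01 h -> cont01 g -> int01 (fun u => h u - g u) = int01 h - int01 g.
Proof. by move=> ch cg; apply: RintegralB => //; exact: cont01_integrable. Qed.

Lemma int01Z a h : cont01 h -> int01 (fun u => a * h u) = a * int01 h.
Proof. by move=> ch; apply: RintegralZl => //; exact: cont01_integrable. Qed.

Lemma int01_le h g : cont01 h -> cont01 g -> (forall u, 0 <= u <= 1 -> h u <= g u) ->
  int01 h <= int01 g.
Proof.
by move=> ch cg hg; apply: le_Rintegral => //; exact: cont01_integrable.
Qed.

Lemma int01_norm_le h M : cont01 h -> (forall u, 0 <= u <= 1 -> `|h u| <= M) -> `|int01 h| <= M.
Proof.
move=> ch hM; rewrite ler_norml -{1}[- M]int01_cst -{2}[M]int01_cst; apply/andP.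
by split; apply: int01_le => //; try exact: cont01_cst; move=> u /hM; rewrite ler_norml => /andP[].
Qed.

Fixpoint riint (s : seq 'I_d) F x : R :=
  if s is i :: s' then int01 (fun u => riint s' F (set_coord x i u)) else F x.

Lemma modulus_int01 F i delta omega : ucont F -> modulus F delta omega ->
  modulus (fun x => int01 (fun u => F (set_coord x i u))) delta omega.
Proof.
move=> uF mF x y cx cy xy; rewrite -int01B; try exact: ucont_slice.
apply: int01_norm_le; first by apply: cont01B; exact: ucont_slice.
move=> u u01; apply: mF; try exact: cube_set_coord.
move=> j; rewrite !mxE; case: eqP => // _; rewrite subrr normr0.
exact: le_trans (normr_ge0 _) (xy j).
Qed.

Lemma ucont_riint s F : ucont F -> ucont (riint s F).
Proof.
move=> uF; elim: s => //= i s IH e e0; have [delta d0 m] := IH e e0.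
by exists delta => //; apply: modulus_int01.
Qed.

Lemma modulus_riint s F delta omega : ucont F -> modulus F delta omega ->
  modulus (riint s F) delta omega.
Proof. by move=> uF mF; elim: s => //= i s IH; apply: modulus_int01 => //; apply: ucont_riint. Qed.

Lemma EFin_riint s F x : ucont F -> cube x ->
  iint_rec s (fun y => (F y)%:E) x = (riint s F x)%:E.
Proof.
move=> uF; elim: s x => //= i s IH x cx.
rewrite -EFin_int01; last by apply: ucont_slice => //; apply: ucont_riint.
by apply: eq_integral => u; rewrite inE /= in_itv /= => u01; apply: IH; apply: cube_set_coord.
Qed.

Lemma eq_riint s F G x : cube x -> (forall y, cube y -> F y = G y) -> riint s F x = riint s G x.
Proof.
move=> + FG; elim: s x => [|i s IH] x cx /=; first exact: FG.
by apply: eq_int01 => u u01; apply: IH; apply: cube_set_coord.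
Qed.

(** Coordinates outside [s] keep their values under the integral, so a factor depending on them
    alone can be treated as a constant. *)
Lemma eq_riint_off s F G x : cube x ->
  (forall y, cube y -> (forall j, j \notin s -> y ord0 j = x ord0 j) -> F y = G y) ->
  riint s F x = riint s G x.
Proof.
elim: s x => [|i s IH] x cx FG /=; first exact: FG.
apply: eq_int01 => u u01; apply: IH => [|y cy yx]; first exact: cube_set_coord.
apply: FG => // j; rewrite in_cons negb_or => /andP[ji js].
by rewrite yx // mxE (negbTE ji).
Qed.

Lemma riintD s F G x : ucont F -> ucont G -> cube x ->
  riint s (fun y => F y + G y) x = riint s F x + riint s G x.
Proof.
move=> uF uG; elim: s x => //= i s IH x cx.
rewrite -int01D; [|by apply: ucont_slice => //; apply: ucont_riint..].
by apply: eq_int01 => u u01; apply: IH; apply: cube_set_coord.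
Qed.

Lemma riintZ s a F x : ucont F -> cube x -> riint s (fun y => a * F y) x = a * riint s F x.
Proof.
move=> uF; elim: s x => //= i s IH x cx.
rewrite -int01Z; last by apply: ucont_slice => //; apply: ucont_riint.
by apply: eq_int01 => u u01; apply: IH; apply: cube_set_coord.
Qed.

Lemma ucont_cst a : ucont (fun=> a).
Proof. by move=> e e0; exists 1 => // x y _ _ _; rewrite subrr normr0 ltW. Qed.

Lemma ucontD F G : ucont F -> ucont G -> ucont (fun y => F y + G y).
Proof.
move=> uF uG e e0; have e2 : 0 < e / 2 by rewrite divr_gt0.
have [d1 d10 h1] := uF _ e2; have [d2 d20 h2] := uG _ e2.
exists (Num.min d1 d2); first by rewrite lt_min d10.
move=> x y cx cy xy; rewrite opprD addrACA (le_trans (ler_normD _ _)) // [leRHS]splitr lerD //.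
  by apply: h1 => // i; apply: le_trans (xy i) _; rewrite ge_min lexx.
by apply: h2 => // i; apply: le_trans (xy i) _; rewrite ge_min lexx orbT.
Qed.

Lemma ucont_sum (I : Type) (r : seq I) (F : I -> 'rV[R]_d -> R) :
  (forall q, ucont (F q)) -> ucont (fun y => \sum_(q <- r) F q y).
Proof.
move=> uF; elim: r => [|q r IH].
  by under eq_fun do rewrite big_nil; exact: ucont_cst.
by under eq_fun do rewrite big_cons; apply: ucontD.
Qed.

Lemma riint_sum (I : Type) (r : seq I) s (F : I -> 'rV[R]_d -> R) x :
  (forall q, ucont (F q)) -> cube x ->
  riint s (fun y => \sum_(q <- r) F q y) x = \sum_(q <- r) riint s (F q) x.
Proof.
move=> uF cx; elim: r => [|q r IH].
  rewrite big_nil; under eq_fun do rewrite big_nil.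
  by elim: s x cx => //= i s IHs x cx; rewrite -[RHS]int01_cst; apply: eq_int01 => u u01;
    apply: IHs; apply: cube_set_coord.
rewrite big_cons -IH -riintD //; last exact: ucont_sum.
by apply: eq_riint => // y _; rewrite big_cons.
Qed.

Fixpoint set_all (s : seq 'I_d) (p : 'I_d -> R) x : 'rV[R]_d :=
  if s is i :: s' then set_all s' p (set_coord x i (p i)) else x.

Lemma set_allE s p x j : set_all s p x ord0 j = if j \in s then p j else x ord0 j.
Proof.
elim: s x => //= i s IH x; rewrite IH in_cons mxE; case: ifP; rewrite ?orbT ?orbF //.
by case: eqP => // ->.
Qed.

Lemma cube_set_all s p x : cube x -> (forall i, 0 <= p i <= 1) -> cube (set_all s p x).
Proof. by move=> cx hp i; rewrite set_allE; case: ifP. Qed.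

(* The weight [w] acts on continuous functions as an approximate evaluation at [p]. *)
Definition approx_eval (w : R -> R) (p delta A : R) : Prop :=
  forall h omega, cont01 h -> 0 <= omega ->
    (forall u, 0 <= u <= 1 -> `|u - p| <= delta -> `|h u - h p| <= omega) ->
    `|int01 (fun u => h u * w u) - h p| <= A * omega.

(** The recursion of the error: if the remaining coordinates leave an error [eta], one more raises
    it to A * (omega + 2 * eta) + eta. *)
Fixpoint approx_cst (A : R) k : R := if k is k'.+1 then A + (2 * A + 1) * approx_cst A k' else 0.

(** One coordinate is evaluated at a time. The inner integral [G] is only within [eta] of values of
    [F], so its oscillation near [p i] is bounded by [omega + 2 * eta]. *)
Lemma riint_approx_eval s F (w : 'I_d -> R -> R) (p : 'I_d -> R) delta omega A x :
  {within cube, continuous F}%classic -> (forall i, continuous (w i)) ->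
  (forall i, 0 <= p i <= 1) -> 0 <= A -> 0 <= omega -> 0 <= delta ->
  (forall i, approx_eval (w i) (p i) delta A) -> modulus F delta omega -> uniq s -> cube x ->
  `|riint s (fun y => F y * \prod_(i <- s) w i (y ord0 i)) x - F (set_all s p x)|
    <= approx_cst A (size s) * omega.
Proof.
move=> cF cw hp A0 o0 dl0 wA mF; elim: s x => [|i s IH] x /=.
  by move=> _ _; rewrite big_nil mulr1 subrr normr0 mul0r.
move=> /andP[nis us] cx.
pose G y := riint s (fun y => F y * \prod_(j <- s) w j (y ord0 j)) y.
have cP s' : continuous (fun y : 'rV[R]_d => \prod_(j <- s') w j (y ord0 j)).
  apply: continuous_bigprod => j y; apply: continuous_comp; first exact: coord_continuous.
  exact: cw.
have uFP s' : ucont (fun y => F y * \prod_(j <- s') w j (y ord0 j)).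
  apply: within_continuous_ucont => y; apply: continuousM; first exact: cF.
  exact: (continuous_subspaceT (cP s')).
have uG : ucont G := ucont_riint s (uFP s).
have E u : 0 <= u <= 1 ->
    riint s (fun y => F y * \prod_(j <- i :: s) w j (y ord0 j)) (set_coord x i u)
    = G (set_coord x i u) * w i u.
  move=> u01; have cxu := cube_set_coord i cx u01; rewrite mulrC -riintZ //.
  apply: eq_riint_off => // y _ yx; rewrite big_cons mulrCA.
  by have := yx i nis; rewrite mxE eqxx => ->.
rewrite (eq_int01 E).
pose h u := F (set_all s p (set_coord x i u)).
have GH u : 0 <= u <= 1 -> `|G (set_coord x i u) - h u| <= approx_cst A (size s) * omega.
  by move=> u01; apply: IH => //; apply: cube_set_coord.
set eta := approx_cst A (size s) * omega in GH *.
have eta0 : 0 <= eta by have := GH (p i) (hp i); apply: le_trans.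
have hmod u : 0 <= u <= 1 -> `|u - p i| <= delta -> `|h u - h (p i)| <= omega.
  move=> u01 up; apply: mF; try by apply: cube_set_all => //; apply: cube_set_coord.
  move=> j; rewrite !set_allE; case: ifP => _; first by rewrite subrr normr0.
  by rewrite !mxE; case: eqP => // _; rewrite subrr normr0.
have key := wA i (fun u => G (set_coord x i u)) (omega + 2 * eta) (@ucont_slice G x i uG cx).
have {}key : `|int01 (fun u => G (set_coord x i u) * w i u) - G (set_coord x i (p i))|
    <= A * (omega + 2 * eta).
  apply: key => [|u u01 up]; first by rewrite addr_ge0 // mulr_ge0.
  have -> : G (set_coord x i u) - G (set_coord x i (p i)) = (G (set_coord x i u) - h u)
    + (h u - h (p i)) + (h (p i) - G (set_coord x i (p i))) by ring.
  have := GH u u01; have := GH (p i) (hp i); have := hmod u u01 up.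
  rewrite [X in _ -> X <= eta -> _]distrC => h1 h2 h3.
  apply: (le_trans (ler_normD _ _)).
  by have := ler_normD (G (set_coord x i u) - h u) (h u - h (p i)); lra.
have := GH (p i) (hp i); rewrite -/(h (p i)) => h3.
rewrite -(subrKA (G (set_coord x i (p i)))); apply: (le_trans (ler_normD _ _)).
rewrite mulrDl -mulrA -/eta; apply: (le_trans (lerD key h3)).
by rewrite le_eqVlt; apply/orP; left; apply/eqP; ring.
Qed.

(** * Dyadic means and integrals *)

Lemma dmean_split m (g : R -> R) :
  dmean m.+1 g = (dmean m (fun u => g (u / 2)) + dmean m (fun u => g ((1 + u) / 2))) / 2.
Proof.
rewrite /dmean (@sum_cV_recl R m (fun b => g (dyadic R b))) big_split /= exprS.
have z : (0 : 'M['F_2]_1) = 0%:M by apply/matrixP => i j; rewrite !mxE mul0rn.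
rewrite (eq_bigr (fun b : 'cV['F_2]_m => g (dyadic R b / 2))) => [|b _]; last first.
  by rewrite z dyadic_col_mx eqxx /= add0r.
rewrite [X in _ * (_ + X)](eq_bigr (fun b : 'cV['F_2]_m => g ((1 + dyadic R b) / 2))) => [|b _].
  by ring.
by rewrite dyadic_col_mx oner_eq0.
Qed.

Lemma eq_dmean m (g k : R -> R) : (forall u, 0 <= u <= 1 -> g u = k u) -> dmean m g = dmean m k.
Proof. by move=> e; congr (_ * _); apply: eq_bigr => b _; rewrite e // dyadic_itv. Qed.

Lemma dmean_dist_le m (g k : R -> R) e :
  (forall u, 0 <= u <= 1 -> `|g u - k u| <= e) -> `|dmean m g - dmean m k| <= e.
Proof.
move=> h; rewrite /dmean -mulrBr -sumrB normrM ger0_norm ?(ltW (half_pow_gt0 _ _)) //.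
have := ler_sum (index_enum 'cV['F_2]_m) (fun b (_ : true) => h (dyadic R b) (dyadic_itv _ _)).
rewrite sumr_const card_mx muln1 card_Fp // => hs.
apply: (@le_trans _ _ (2^-1 ^+ m * (2 ^+ m * e))); last by rewrite mulrA half_pow_inv mul1r.
apply: ler_wpM2l; first exact: ltW (half_pow_gt0 _ _).
apply: le_trans (ler_norm_sum _ _ _) _; apply: le_trans hs _.
by rewrite -[e *+ _]mulr_natl natrX.
Qed.

Definition prim h a : R := (\int[mu]_(u in `[0%R, a]%classic) h u)%R.

Lemma prim_dist h a b c omega : cont01 h -> 0 <= a -> a < b -> b <= 1 ->
  (forall u, a <= u <= b -> `|h u - h c| <= omega) ->
  `|(prim h b - prim h a) / (b - a) - h c| <= omega.
Proof.
move=> ch a0 ab b1 hw.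
have sub : (`]a, b] `<=` I01)%classic.
  by move=> u /=; rewrite !in_itv /= => /andP[au ub]; apply/andP; split; lra.
have int0b : mu.-integrable `[0%R, b]%classic (EFin \o h).
  apply: integrableS (cont01_integrable ch) => // u /=.
  by rewrite !in_itv /= => /andP[u0 ub]; apply/andP; split; lra.
have intab : mu.-integrable `]a, b]%classic (EFin \o h).
  exact: integrableS (cont01_integrable ch).
have muab : mu `]a, b]%classic = (b - a)%:E.
  by rewrite lebesgue_measure_itv /= lte_fin ab -EFinB.
have intc k : mu.-integrable `]a, b]%classic (EFin \o (fun=> k : R)).
  exact: integrableS (cont01_integrable (@cont01_cst k)).
have e : prim h b - prim h a = (\int[mu]_(u in `]a, b]%classic) h u)%R.
  by rewrite /prim Rintegral_itvB // bnd_simp // ltW.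
have ba0 : 0 < b - a by rewrite subr_gt0.
have ec k : (\int[mu]_(u in `]a, b]%classic) k)%R = k * (b - a) by rewrite Rintegral_cst //= muab.
have -> : (prim h b - prim h a) / (b - a) - h c = (prim h b - prim h a - h c * (b - a)) / (b - a).
  by field; rewrite gt_eqF.
rewrite normrM [`|(b - a)^-1|]ger0_norm ?invr_ge0 ?(ltW ba0) // ler_pdivrMr //.
rewrite e -ec -RintegralB //.
have intd : mu.-integrable `]a, b]%classic (EFin \o (fun u => h u - h c)).
  apply: integrableS (cont01_integrable (cont01B ch (@cont01_cst (h c)))) => //.
have bnd u : `]a, b]%classic u -> - omega <= h u - h c <= omega.
  by rewrite /= in_itv /= => /andP[au ub]; rewrite -ler_norml; apply: hw; lra.
rewrite ler_norml -mulNr -!ec; apply/andP; split; apply: le_Rintegral => // u /bnd /andP[] //.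
Qed.

(** The quotient is the mean of [h] between the two points in either order; [b < a] is included for
    the decreasing branch of the tent. The induction halves the interval. *)
Lemma dmean_affine_dist h m a b omega : cont01 h -> 0 <= a <= 1 -> 0 <= b <= 1 -> a != b ->
  (forall u v, 0 <= u <= 1 -> 0 <= v <= 1 -> `|u - v| <= `|b - a| * 2^-1 ^+ m ->
     `|h u - h v| <= omega) ->
  `|dmean m (fun u => h (a + (b - a) * u)) - (prim h b - prim h a) / (b - a)| <= omega.
Proof.
move=> ch; elim: m a b => [|m IH] a b a01 b01 ab hw.
  have -> : dmean 0 (fun u => h (a + (b - a) * u)) = h a.
    rewrite /dmean expr0 mul1r (eq_bigr (fun=> h a)) => [|v _].
      by rewrite sumr_const card_mx muln1 expn0.
    by rewrite /dyadic big_ord0 mulr0 addr0.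
  rewrite expr0 mulr1 in hw; rewrite distrC.
  have [lt|lt|e] := ltgtP a b; last by rewrite e eqxx in ab.
    apply: prim_dist => //; try lra; move=> u u01; apply: hw; try lra.
    by rewrite !ger0_norm; lra.
  have -> : (prim h b - prim h a) / (b - a) = (prim h a - prim h b) / (a - b).
    by rewrite -opprB -[b - a]opprB invrN mulrNN.
  apply: prim_dist => //; try lra; move=> u u01; apply: hw; try lra.
  by rewrite !ler0_norm; lra.
pose c := (a + b) / 2.
have ac : a != c by apply: contra ab => /eqP; rewrite /c => e; apply/eqP; lra.
have cb : c != b by apply: contra ab => /eqP; rewrite /c => e; apply/eqP; lra.
have c01 : 0 <= c <= 1 by rewrite /c; lra.
have hw1 k : k = 2^-1 * (b - a) -> forall u v, 0 <= u <= 1 -> 0 <= v <= 1 ->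
    `|u - v| <= `|k| * 2^-1 ^+ m -> `|h u - h v| <= omega.
  move=> -> u v u01 v01 uv; apply: hw => //; apply: le_trans uv _.
  by rewrite normrM [`|2^-1|]ger0_norm ?invr_ge0 // exprS mulrAC mulrC mulrA.
have := IH a c a01 c01 ac (hw1 (c - a) _); have := IH c b c01 b01 cb (hw1 (b - c) _).
rewrite dmean_split => /(_ _) H2 /(_ _) H1.
have {}H2 : `|dmean m (fun u => h (c + (b - c) * u)) - (prim h b - prim h c) / (b - c)| <= omega.
  by apply: H2; rewrite /c; field.
have {}H1 : `|dmean m (fun u => h (a + (c - a) * u)) - (prim h c - prim h a) / (c - a)| <= omega.
  by apply: H1; rewrite /c; field.
have e1 : (fun u => h (a + (b - a) * (u / 2))) = (fun u => h (a + (c - a) * u)).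
  by apply/funext => u; congr h; rewrite /c; field.
have e2 : (fun u => h (a + (b - a) * ((1 + u) / 2))) = (fun u => h (c + (b - c) * u)).
  by apply/funext => u; congr h; rewrite /c; field.
rewrite e1 e2.
have ba : b - a != 0 by rewrite subr_eq0 eq_sym.
have -> : (prim h b - prim h a) / (b - a) =
   ((prim h c - prim h a) / (c - a) + (prim h b - prim h c) / (b - c)) / 2.
  have -> : c - a = (b - a) / 2 by rewrite /c; field.
  have -> : b - c = (b - a) / 2 by rewrite /c; field.
  by field.
move: H1 H2; set X := dmean _ _; set Y := dmean _ _; set P := _ / (c - a); set Q := _ / (b - c).
move=> H1 H2; have -> : (X + Y) / 2 - (P + Q) / 2 = ((X - P) + (Y - Q)) / 2 by ring.
rewrite normrM [`|2^-1|]ger0_norm ?invr_ge0 // ler_pdivrMr //.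
by have := ler_normD (X - P) (Y - Q); lra.
Qed.

Definition tent u : R := `|2 * u - 1|.

(** The tent folds the grid of [m.+1] digits into two grids of [m] digits, one running down from 1
    and the other up from 0. *)
Lemma dmean_tent_dist h m omega : cont01 h ->
  (forall u v, 0 <= u <= 1 -> 0 <= v <= 1 -> `|u - v| <= 2^-1 ^+ m -> `|h u - h v| <= omega) ->
  `|dmean m.+1 (h \o tent) - int01 h| <= omega.
Proof.
move=> ch hw; rewrite dmean_split.
have e1 : dmean m (fun u => (h \o tent) (u / 2)) = dmean m (fun u => h (1 + (0 - 1) * u)).
  apply: eq_dmean => u u01; rewrite /= /tent; congr h.
  have -> : 2 * (u / 2) - 1 = u - 1 by field.
  by rewrite ler0_norm; lra.
have e2 : dmean m (fun u => (h \o tent) ((1 + u) / 2)) = dmean m (fun u => h (0 + (1 - 0) * u)).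
  apply: eq_dmean => u u01; rewrite /= /tent; congr h.
  have -> : 2 * ((1 + u) / 2) - 1 = u by field.
  by rewrite ger0_norm; lra.
have i01 : 0 <= (0 : R) <= 1 by rewrite lexx ler01.
have i11 : 0 <= (1 : R) <= 1 by rewrite lexx ler01.
have n01 : (0 : R) != 1 by rewrite eq_sym oner_eq0.
have := @dmean_affine_dist h m 1 0 omega ch i11 i01 (oner_neq0 _).
have := @dmean_affine_dist h m 0 1 omega ch i01 i11 n01.
have p0 : prim h 0 = 0 by rewrite /prim set_itv1 Rintegral_set1.
rewrite p0 -[prim h 1]/(int01 h) !subr0 !sub0r normrN normr1 mul1r invrN1 mulrNN mulr1 invr1.
rewrite e1 e2 !sub0r !subr0 => /(_ hw) H2 /(_ hw) H1.
move: H1 H2; set X := dmean _ _; set Y := dmean _ _ => H1 H2.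
have -> : (X + Y) / 2 - int01 h = ((X - int01 h) + (Y - int01 h)) / 2 by field.
rewrite normrM [`|2^-1|]ger0_norm ?invr_ge0 // ler_pdivrMr //.
by have := ler_normD (X - int01 h) (Y - int01 h); rewrite mulr1 in H2; lra.
Qed.

Lemma tent_itv u : 0 <= u <= 1 -> 0 <= tent u <= 1.
Proof. by move=> u01; rewrite /tent normr_ge0 ler_norml; lra. Qed.

Fixpoint imean m (s : seq 'I_d) F x : R :=
  if s is i :: s' then dmean m (fun u => imean m s' F (set_coord x i (tent u))) else F x.

Lemma imean_dist m s F omega x : ucont F -> modulus F (2^-1 ^+ m) omega -> cube x ->
  `|imean m.+1 s F x - riint s F x| <= (size s)%:R * omega.
Proof.
move=> uF mF; elim: s x => [|i s IH] x cx /=; first by rewrite subrr normr0 mul0r.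
have H := @dmean_tent_dist (fun u => riint s F (set_coord x i u)) m omega
  (@ucont_slice _ x i (ucont_riint s uF) cx).
have {}H : `|dmean m.+1 (fun u => riint s F (set_coord x i (tent u)))
    - int01 (fun u => riint s F (set_coord x i u))| <= omega.
  apply: H => u v u01 v01 uv; apply: (modulus_riint s uF mF); try exact: cube_set_coord.
  move=> j; rewrite !mxE; case: eqP => // _; rewrite subrr normr0.
  exact: ltW (half_pow_gt0 _ _).
have G : `|dmean m.+1 (fun u => imean m.+1 s F (set_coord x i (tent u)))
    - dmean m.+1 (fun u => riint s F (set_coord x i (tent u)))| <= (size s)%:R * omega.
  by apply: dmean_dist_le => u u01; apply: IH; apply: cube_set_coord => //; apply: tent_itv.
rewrite -(subrKA (dmean m.+1 (fun u => riint s F (set_coord x i (tent u))))).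
by apply: (le_trans (ler_normD _ _)); rewrite -natr1 mulrDl mul1r lerD.
Qed.

End UniformlyContinuous.

(** * Iterated Lebesgue integrals of the weak derivatives *)

Section IteratedLebesgue.
Variables (R : realType) (d : nat).
Local Notation mu := (@lebesgue_measure R).
Local Notation cube := (@unit_cube R d).
Local Notation I01 := `[0%R : R, 1%R]%classic.
Local Open Scope classical_set_scope.
Local Open Scope ereal_scope.

(** The integral of a nonnegative function is a supremum over simple functions below it, hence
    monotone without measurability. Partial integrals of [g * phi] thus need not be shown
    measurable. *)
Lemma ge0_integral_le_nomeas (f k : R -> \bar R) : (forall u, I01 u -> 0 <= f u <= k u) ->
  \int[mu]_(u in I01) f u <= \int[mu]_(u in I01) k u.
Proof.
move=> fk; rewrite integral_mkcond [leRHS]integral_mkcond.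
rewrite !ge0_integralTE; last 2 first.
- by move=> u; rewrite patchE; case: ifPn => // /set_mem/fk/andP[f0 fk']; exact: le_trans fk'.
- by move=> u; rewrite patchE; case: ifPn => // /set_mem/fk/andP[].
apply: le_ereal_sup => _ [h hf <-]; exists h => // u; apply: le_trans (hf u) _.
by rewrite !patchE; case: ifPn => // /set_mem/fk/andP[].
Qed.

(* No measurability of [f]: both parts of [f] have integral at most that of [k]. *)
Lemma abse_integral_le (f k : R -> \bar R) : (forall u, I01 u -> `|f u| <= k u) ->
  `|\int[mu]_(u in I01) f u| <= \int[mu]_(u in I01) k u.
Proof.
move=> fk; rewrite integralE.
have hp : \int[mu]_(u in I01) f^\+ u <= \int[mu]_(u in I01) k u.
  apply: ge0_integral_le_nomeas => u /fk fku; rewrite funeposE le_max lexx orbT /=.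
  by apply: le_trans fku; rewrite ge_max abse_ge0 lee_abs.
have hn : \int[mu]_(u in I01) f^\- u <= \int[mu]_(u in I01) k u.
  apply: ge0_integral_le_nomeas => u /fk fku; rewrite funenegE le_max lexx orbT /=.
  by apply: le_trans fku; rewrite ge_max abse_ge0 -abseN lee_abs.
have p0 : 0 <= \int[mu]_(u in I01) f^\+ u by apply: integral_ge0 => u _; rewrite funeposE le_max lexx orbT.
have n0 : 0 <= \int[mu]_(u in I01) f^\- u by apply: integral_ge0 => u _; rewrite funenegE le_max lexx orbT.
move: p0 n0 hp hn; move: (\int[mu]_(u in I01) f^\+ u) (\int[mu]_(u in I01) f^\- u) (\int[mu]_(u in I01) k u).
move=> [p| |] [q| |] [K| |] //=; rewrite ?leey // !lee_fin => p0 q0 pK qK.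
by rewrite ler_norml; apply/andP; split; lra.
Qed.

Lemma abse_iint_rec_le s (f k : 'rV[R]_d -> \bar R) x : cube x ->
  (forall y, cube y -> `|f y| <= k y) -> `|iint_rec s f x| <= iint_rec s k x.
Proof.
move=> + fk; elim: s x => [|i s IH] x cx /=; first exact: fk.
apply: abse_integral_le => u; rewrite /= in_itv /= => u01.
by apply: IH; apply: cube_set_coord.
Qed.

Definition meas_row (g : 'rV[R]_d -> \bar R) : Prop :=
  measurable_fun [set: d.-tuple R] (g \o @rv_of_tuple R d).

Definition set_tuple (t : d.-tuple R) (i : 'I_d) (u : R) : d.-tuple R :=
  [tuple if j == i then u else tnth t j | j < d].

Lemma set_coord_rv_of_tuple t i u :
  set_coord (rv_of_tuple t) i u = rv_of_tuple (set_tuple t i u).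
Proof. by apply/rowP => j; rewrite !mxE tnth_mktuple. Qed.

Lemma measurable_set_tuple i :
  measurable_fun [set: d.-tuple R * R] (fun p => set_tuple p.1 i p.2).
Proof.
apply/measurable_fun_tnthP => j /=.
rewrite (_ : _ \o _ = (fun p : d.-tuple R * R => if j == i then p.2 else tnth p.1 j)); last first.
  by apply/funext => p /=; rewrite tnth_mktuple.
case: eqP => _; first exact: measurable_snd.
apply: (@measurableT_comp _ _ _ _ _ _ (fun t : d.-tuple R => tnth t j) setT (@fst (d.-tuple R) R)).
  exact: measurable_tnth.
exact: measurable_fst.
Qed.

Lemma meas_row_slice g (x : 'rV[R]_d) i : meas_row g ->
  measurable_fun [set: R] (fun u => g (set_coord x i u)).
Proof.
move=> mg; pose t := [tuple x ord0 j | j < d].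
have xt : x = rv_of_tuple t by apply/rowP => j; rewrite mxE tnth_mktuple.
rewrite (_ : (fun u => _) = (g \o @rv_of_tuple R d) \o (fun u => set_tuple t i u)); last first.
  by apply/funext => u /=; rewrite xt set_coord_rv_of_tuple.
apply: (measurableT_comp mg).
apply: (@measurableT_comp _ _ _ _ _ _ (fun p : d.-tuple R * R => set_tuple p.1 i p.2) setT
  (fun u : R => (t, u))); first exact: measurable_set_tuple.
by apply: measurable_fun_pair => //; exact: measurable_cst.
Qed.

Lemma meas_row_integral g i : meas_row g -> (forall y, 0 <= g y) ->
  meas_row (fun x => \int[mu]_(u in I01) g (set_coord x i u)).
Proof.
move=> mg g0.
(* The indicator turns the inner integral into one over the whole line, the form of Tonelli's
   theorem. *)
pose f (p : d.-tuple R * R) := (g \o @rv_of_tuple R d) (set_tuple p.1 i p.2) * (\1_I01 p.2)%:E.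
have mf : measurable_fun [set: d.-tuple R * R] f.
  apply: emeasurable_funM; first exact: (measurableT_comp mg (measurable_set_tuple i)).
  apply/measurable_EFinP; 
  apply: (@measurableT_comp _ _ _ _ _ _ (\1_I01 : R -> R) setT (@snd (d.-tuple R) R)).
    by apply: measurable_indic.
  exact: measurable_snd.
have f0 p : 0 <= f p by rewrite mule_ge0 // ?g0 // lee_fin.
have := measurable_fun_fubini_tonelli_F (m2 := mu) f mf f0.
rewrite /meas_row; apply: eq_measurable_fun => t _ /=; rewrite /fubini_F [RHS]integral_mkcond.
apply: eq_integral => u _; rewrite epatch_indic /f /= set_coord_rv_of_tuple //.
Qed.

Lemma iint_rec_ge0 s (g : 'rV[R]_d -> \bar R) x : (forall y, 0 <= g y) -> 0 <= iint_rec s g x.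
Proof. by move=> g0; elim: s x => //= i s IH x; apply: integral_ge0. Qed.

Lemma meas_row_iint s g : meas_row g -> (forall y, 0 <= g y) -> meas_row (iint_rec s g).
Proof.
move=> mg g0; elim: s => //= i s IH; apply: meas_row_integral => // y.
exact: iint_rec_ge0.
Qed.

Lemma iint_rec_affine s (a b : R) (g : 'rV[R]_d -> \bar R) x :
  meas_row g -> (forall y, 0 <= g y) -> (0 <= a)%R -> (0 <= b)%R ->
  iint_rec s (fun y => a%:E + b%:E * g y) x = a%:E + b%:E * iint_rec s g x.
Proof.
move=> mg g0 a0 b0; elim: s x => //= i s IH x.
transitivity (\int[mu]_(u in I01) (a%:E + b%:E * iint_rec s g (set_coord x i u))).
  by apply: eq_integral => u _; exact: IH.
have ms : measurable_fun [set: R] (fun u => iint_rec s g (set_coord x i u)).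
  by apply: meas_row_slice; apply: meas_row_iint.
have ms01 : measurable_fun I01 (fun u => iint_rec s g (set_coord x i u)).
  exact: measurable_funS ms.
rewrite ge0_integralD //; first last.
- by apply: emeasurable_funM => //; exact: measurable_cst.
- by move=> u _; rewrite mule_ge0 // iint_rec_ge0.
rewrite integral_cst // ge0_integralZl //; last by move=> u _; exact: iint_rec_ge0.
by congr (_ + _); rewrite -[RHS]mule1; congr (_ * _); exact: mu01.
Qed.

(** In place of the Cauchy-Schwarz inequality, |g phi| <= M |g| <= M (1 + g^2) / 2 holds pointwise;
    as the cube has volume one and [g] norm at most one, the majorant integrates to at most [M].
    Only this nonnegative majorant needs linearity of the iterated integral. *)
Lemma cube_integral_pairing_le (g phi : 'rV[R]_d -> R) (M : R) :
  measurable_fun [set: d.-tuple R] (g \o @rv_of_tuple R d) ->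
  cube_integral (fun x => (g x ^+ 2)%:E) <= 1 ->
  (forall y, cube y -> `|phi y|%R <= M)%R -> (0 <= M)%R ->
  `|cube_integral (fun x => (g x * phi x)%:E)| <= M%:E.
Proof.
move=> mg g2 hphi M0.
have M20 : (0 <= M / 2)%R by rewrite divr_ge0.
have mg2 : meas_row (fun y => (g y ^+ 2)%:E).
  by have m2 := measurable_funX 2 mg; apply/measurable_EFinP; exact: m2.
have g20 y : 0 <= (g y ^+ 2)%:E by rewrite lee_fin sqr_ge0.
have := @abse_iint_rec_le (enum 'I_d) (fun x => (g x * phi x)%:E)
  (fun y => (M / 2)%:E + (M / 2)%:E * (g y ^+ 2)%:E) 0 (@cube0 R d).
rewrite iint_rec_affine // => h; apply: le_trans (h _) _.
  move=> y cy; rewrite -EFinM -EFinD /= lee_fin normrM.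
  have hM := hphi y cy; have := normr_ge0 (g y); rewrite -[(g y ^+ 2)%R]real_normK ?num_real //.
  move: (`|g y|)%R (`|phi y|)%R hM (normr_ge0 (phi y)) => G P hM P0 G0; rewrite /=.
  have := sqr_ge0 (G - 1)%R; have : (G * P <= G * M)%R by apply: ler_wpM2l.
  by move=> h1 h2; apply: le_trans h1 _; have := mulr_ge0 M0 h2; lra.
apply: (@le_trans _ _ ((M / 2)%:E + (M / 2)%:E * 1)).
  by rewrite leeD2l // lee_wpmul2l // lee_fin.
by rewrite mule1 -EFinD lee_fin; lra.
Qed.

End IteratedLebesgue.

(** * Kernels *)

Section Atoms.
Variable R : realType.
Implicit Types (x y z c e u : R).
Local Notation I01 := `[0%R : R, 1%R]%classic.
Local Notation cont01 h := ({within I01, continuous h}%classic).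

(** The antiderivative is constant outside [a, b], so its whole increment is a mean of [k] over
    [a, b] times the length. *)
Lemma int01_local (k : R -> R) a b K : cont01 k -> 0 < a -> a < b -> b < 1 ->
  (forall u, 0 <= u <= a -> k u = 0) -> (forall u, b <= u <= 1 -> k u = 0) ->
  (forall u, a <= u <= b -> `|k u| <= K) -> `|int01 k| <= K * (b - a).
Proof.
move=> ck a0 ab b1 ka kb kK.
have p0 : prim k 0 = 0 by rewrite /prim set_itv1 Rintegral_set1.
have pa : prim k a = 0.
  have := @prim_dist _ k 0 a a 0 ck (lexx 0) a0 (ltW (lt_trans ab b1)).
  rewrite p0 !subr0 (ka a) ?subr0; last by rewrite lexx ltW.
  move=> h; have {}h : `|prim k a / a| <= 0 by apply: h => u u01; rewrite ka // subr0 normr0.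
  by move: h; rewrite normr_le0 mulf_eq0 invr_eq0 (gt_eqF a0) orbF => /eqP.
have pb : prim k 1 = prim k b.
  have := @prim_dist _ k b 1 b 0 ck (ltW (lt_trans a0 ab)) b1 (lexx 1).
  rewrite (kb b) ?subr0; last by rewrite lexx ltW.
  move=> h; have {}h : `|(prim k 1 - prim k b) / (1 - b)| <= 0.
    by apply: h => u u01; rewrite kb // subr0 normr0.
  move: h; rewrite normr_le0 mulf_eq0 invr_eq0 subr_eq0 => /orP[|]; first by move=> /eqP.
  by rewrite subr_eq0 (gt_eqF b1).
have := @prim_dist _ k a b a K ck (ltW a0) ab (ltW b1).
rewrite (ka a) ?lexx ?(ltW a0) // subr0 pa subr0 -pb -[prim k 1]/(int01 k) => h.
have ba : 0 < b - a by rewrite subr_gt0.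
rewrite -ler_pdivrMr //; have {}h : `|int01 k / (b - a)| <= K.
  by apply: h => u u01; rewrite subr0; apply: kK.
by move: h; rewrite normrM [`|(b - a)^-1|]ger0_norm // invr_ge0 ltW.
Qed.

Lemma smooth_cont01 (f : R -> R) : smooth f -> cont01 f.
Proof. by move=> sf; apply: continuous_subspaceT; exact: smooth_continuous. Qed.

Lemma int01_derive (f : R -> R) : smooth f -> int01 (derive1 f) = f 1 - f 0.
Proof.
move=> sf; have cf := smooth_continuous sf.
have := @continuous_FTC2 R (derive1 f) f 0 1 ltr01 (smooth_cont01 (smooth_derive1 sf)).
rewrite EFin_int01; last exact/smooth_cont01/smooth_derive1.
rewrite -EFinB => h; apply: EFin_inj; apply: h => //.
split; first by move=> u _; exact: smooth_derivable.
- by apply: cvg_at_right_filter; exact: cf.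
- by apply: cvg_at_left_filter; exact: cf.
Qed.

(** A smooth positive part, equal to 0 below 1/3 and to [z] above 2/3. The margins inside [0, 1] let
    its derivatives at 0 and 1 be read off from a constant and a linear function nearby. *)
Definition ramp z : R := z * step (3 * z - 1).

Lemma smooth_ramp : smooth ramp.
Proof.
apply: smoothM; first exact: smooth_id.
exact: smooth_affine (smooth_step R).
Qed.

Lemma ramp_near0 z : z < 3^-1 -> \forall t \near z, ramp t = 0.
Proof.
move=> z3; near=> t; rewrite /ramp step0 ?mulr0 //.
have : t < 3^-1 by near: t; exact: lt_nbhsl.
lra.
Unshelve. all: by end_near. Qed.

Lemma ramp_near1 z : 2 / 3 < z -> \forall t \near z, ramp t = t.
Proof.
move=> z3; near=> t; rewrite /ramp step1 ?mulr1 //.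
have : 2 / 3 < t by near: t; exact: lt_nbhsr.
lra.
Unshelve. all: by end_near. Qed.

Lemma derive1_id_fun : derive1 (fun z : R => z) = fun=> 1.
Proof. by apply/funext => z; rewrite derive1E; apply: derive_val. Qed.

Lemma ramp'_near0 z : z < 3^-1 -> \forall t \near z, derive1 ramp t = 0.
Proof.
move=> z3; near=> t; rewrite (@derive1_near _ ramp (fun=> 0)) ?derive1_cst_fun //.
by apply: ramp_near0; near: t; exact: lt_nbhsl.
Unshelve. all: by end_near. Qed.

Lemma ramp'_near1 z : 2 / 3 < z -> \forall t \near z, derive1 ramp t = 1.
Proof.
move=> z3; near=> t; rewrite (@derive1_near _ ramp (fun z => z)) ?derive1_id_fun //.
by apply: ramp_near1; near: t; exact: lt_nbhsr.
Unshelve. all: by end_near. Qed.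

Lemma ramp'0 z : z <= 0 -> derive1 ramp z = 0.
Proof. by move=> z0; apply: (nbhs_singleton (ramp'_near0 _)); lra. Qed.

Lemma ramp'1 z : 1 <= z -> derive1 ramp z = 1.
Proof. by move=> z1; apply: (nbhs_singleton (ramp'_near1 _)); lra. Qed.

Lemma ramp''0 z : z <= 0 \/ 1 <= z -> derive1 (derive1 ramp) z = 0.
Proof.
move=> [z0|z1].
  by rewrite (@derive1_near _ _ (fun=> 0)) ?derive1_cst_fun //; apply: ramp'_near0; lra.
by rewrite (@derive1_near _ _ (fun=> 1)) ?derive1_cst_fun //; apply: ramp'_near1; lra.
Qed.

Lemma ramp_dist z : `|ramp z - Num.max z 0| <= 1.
Proof.
rewrite /ramp; have [z0|z0] := leP z 0.
  by rewrite step0 ?mulr0 ?subrr ?normr0 //; lra.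
have [z1|z1] := leP 1 z.
  by rewrite step1 ?mulr1 ?subrr ?normr0 //; lra.
have /andP[s0 s1] := step_itv (3 * z - 1); rewrite ler_norml; apply/andP; split.
  by have := mulr_ge0 (ltW z0) s0; lra.
by have := ler_wpM2l (ltW z0) s1; lra.
Qed.

(* [atom e c] is a smooth version of the positive part of [y - c]; its second
   derivative is concentrated on [c, c + e]. *)
Definition atom e c y : R := e * ramp ((y - c) / e).

Lemma smooth_atom e c : smooth (atom e c).
Proof. by apply: smoothZ; apply: smooth_rescale; exact: smooth_ramp. Qed.

Lemma atom' e c : e != 0 -> derive1 (atom e c) = fun y => derive1 ramp ((y - c) / e).
Proof.
move=> e0; have sr := smooth_rescale c e smooth_ramp.
rewrite /atom (derive1_smoothM (smooth_cst e) sr) derive1_cst_fun.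
rewrite (derive1_rescale _ _ smooth_ramp); apply/funext => y.
by rewrite mulr0 addr0 mulrA divff // mul1r.
Qed.

Lemma atom'' e c : e != 0 ->
  derive1 (derive1 (atom e c)) = fun y => e^-1 * derive1 (derive1 ramp) ((y - c) / e).
Proof. by move=> e0; rewrite atom' // (derive1_rescale _ _ (smooth_derive1 smooth_ramp)). Qed.

(** Maps [0, 1] affinely onto [e, 1 - 2e], so that the interval [c, c + e] carrying the point mass
    stays in [e, 1 - e] even for [x] on the boundary. *)
Definition center e x : R := e + (1 - 3 * e) * x.

Lemma center_dist e x : 0 < e <= 4^-1 -> 0 <= x <= 1 ->
  [/\ e <= center e x, center e x + e <= 1 - e & `|center e x - x| <= 2 * e].
Proof.
move=> /andP[e0 e1] /andP[x0 x1]; rewrite /center.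
have h1 := mulr_ge0 (ltW e0) x0.
have h2 : e * x <= e by rewrite -[leRHS]mulr1 ler_wpM2l // ltW.
have -> : (1 - 3 * e) * x = x - 3 * (e * x) by ring.
by split; [nra | nra | rewrite ler_norml; lra].
Qed.

(** The weight has integral 1, as the derivative of [ramp] climbs from 0 to 1, lives on an interval
    of length [e] and is at most [A / e]; it may change sign, hence the loss [A]. The radius [3 * e]
    is the shift of the centre plus the length of the support. *)
Lemma approx_eval_atom e x A : 0 < e <= 4^-1 -> 0 <= x <= 1 ->
  (forall z, 0 <= z <= 1 -> `|derive1 (derive1 ramp) z| <= A) ->
  approx_eval (derive1 (derive1 (atom e (center e x)))) x (3 * e) A.
Proof.
move=> he hx hA h omega ch o0 hw.
have [c1 c2 c3] := center_dist he hx; set c := center e x in c1 c2 c3 *.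
have /andP[e0 _] := he; have ne : e != 0 by rewrite gt_eqF.
set w := derive1 _.
have sw : smooth w by do 2 apply: smooth_derive1; exact: smooth_atom.
have cw := smooth_cont01 sw.
have iw : int01 w = 1.
  rewrite /w int01_derive; last by apply: smooth_derive1; exact: smooth_atom.
  rewrite atom' // ramp'1 ?ramp'0 ?subr0 //.
    by rewrite ler_pdivrMr // mul0r; lra.
  by rewrite ler_pdivlMr // mul1r; lra.
have -> : int01 (fun u => h u * w u) - h x = int01 (fun u => (h u - h x) * w u).
  rewrite -{1}[h x]mulr1 -iw -int01Z // -int01B //; last 2 first.
  - exact: cont01M.
  - by apply: cont01M => //; exact: cont01_cst.
  by apply: eq_int01 => u _; rewrite mulrBl.
have cz : c < c + e by rewrite ltrDl.
have w0 u : u <= c \/ c + e <= u -> w u = 0.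
  move=> hu; rewrite /w atom'' // ramp''0 ?mulr0 //.
  by case: hu => hu; [left; rewrite ler_pdivrMr // mul0r; lra|right; rewrite ler_pdivlMr // mul1r; lra].
have := @int01_local (fun u => (h u - h x) * w u) c (c + e) (omega * (A / e)).
have -> : omega * (A / e) * (c + e - c) = A * omega by field.
apply=> //; try lra.
- by apply: cont01M => //; apply: cont01B => //; exact: cont01_cst.
- by move=> u u01; rewrite w0 ?mulr0 //; left; lra.
- by move=> u u01; rewrite w0 ?mulr0 //; right; lra.
move=> u u01; rewrite normrM; apply: ler_pM => //.
  apply: hw; first lra.
  by move: c3; rewrite !ler_norml; lra.
rewrite /w atom'' // normrM ger0_norm ?invr_ge0 ?(ltW e0) // mulrC ler_wpM2r ?invr_ge0 ?(ltW e0) //.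
by apply: hA; rewrite ler_pdivrMr // divr_ge0 ?(ltW e0) //; lra.
Qed.

Definition cutoff y : R := step (2 * y - 2^-1).

Lemma smooth_cutoff : smooth cutoff.
Proof. exact: smooth_affine (smooth_step R). Qed.

Lemma cutoff0 y : y <= 4^-1 -> cutoff y = 0.
Proof. by move=> h; apply: step0; lra. Qed.

Lemma cutoff1 y : 3 / 4 <= y -> cutoff y = 1.
Proof. by move=> h; apply: step1; lra. Qed.

(** Agrees with the atom near 1 and vanishes near 0: the difference has compact support in the open
    interval. *)
Definition cut_line c y : R := (y - c) * cutoff y.

Lemma smooth_cut_line c : smooth (cut_line c).
Proof. by apply: smoothM; [exact: smooth_subc|exact: smooth_cutoff]. Qed.

Lemma cut_line'' c : derive1 (derive1 (cut_line c))
  = fun y => 2 * derive1 cutoff y + (y - c) * derive1 (derive1 cutoff) y.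
Proof.
have sc := smooth_subc c; have sS := smooth_cutoff; have sS' := smooth_derive1 sS.
rewrite /cut_line derive1_smoothM // derive1_subc derive1_smoothD; first last.
- by apply: smoothM => //; exact: smooth_cst.
- by apply: smoothM.
rewrite derive1_smoothM // derive1_subc derive1_smoothM //; last exact: smooth_cst.
by rewrite derive1_cst_fun; apply/funext => y; ring.
Qed.

Lemma cut_line''0 c y : y < 4^-1 \/ 3 / 4 < y -> derive1 (derive1 (cut_line c)) y = 0.
Proof.
have near0 z : z < 4^-1 -> \forall t \near z, cut_line c t = 0.
  move=> z4; near=> t; rewrite /cut_line cutoff0 ?mulr0 //.
  by apply/ltW; near: t; exact: lt_nbhsl.
have near1 z : 3 / 4 < z -> \forall t \near z, cut_line c t = t - c.
  move=> z4; near=> t; rewrite /cut_line cutoff1 ?mulr1 //.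
  by apply/ltW; near: t; exact: lt_nbhsr.
move=> [y4|y4].
  rewrite (@derive1_near _ _ (fun=> 0)) ?derive1_cst_fun //; near=> t.
  rewrite (@derive1_near _ _ (fun=> 0)) ?derive1_cst_fun //; apply: near0.
  by near: t; exact: lt_nbhsl.
rewrite (@derive1_near _ _ (fun=> 1)) ?derive1_cst_fun //; near=> t.
rewrite (@derive1_near _ _ (fun z => z - c)) ?derive1_subc //; apply: near1.
by near: t; exact: lt_nbhsr.
Unshelve. all: by end_near. Qed.

(** The limit of [sker] as [e] tends to 0 and the centre to [x]; the second branch is the second
    derivative of [cut_line x]. *)
Definition ker (b : bool) x y : R :=
  if b then Num.max (y - x) 0 - (y - x) * cutoff y
  else 2 * derive1 cutoff y + (y - x) * derive1 (derive1 cutoff) y.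

Definition sker (b : bool) e c y : R :=
  if b then atom e c y - cut_line c y else derive1 (derive1 (cut_line c)) y.

Lemma smooth_sker b e c : smooth (sker b e c).
Proof.
case: b; first by apply: smoothB; [exact: smooth_atom|exact: smooth_cut_line].
by do 2 apply: smooth_derive1; exact: smooth_cut_line.
Qed.

Lemma sker_supp b e x y : 0 < e <= 4^-1 -> 0 <= x <= 1 -> y < e \/ 1 - e < y ->
  sker b e (center e x) y = 0.
Proof.
move=> he hx hy; have [c1 c2 _] := center_dist he hx; have /andP[e0 e1] := he.
case: b => /=; last by apply: cut_line''0; case: hy; [left|right]; lra.
rewrite /atom /cut_line /ramp; set c := center e x in c1 c2 *.
case: hy => hy.
  rewrite cutoff0 ?mulr0 ?subr0; last lra.
  rewrite step0 ?mulr0 //; suff : (y - c) / e <= 0 by lra.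
  by rewrite ler_pdivrMr // mul0r; lra.
rewrite cutoff1 ?mulr1; last lra.
rewrite step1 ?mulr1; first by field; rewrite gt_eqF.
suff : 1 <= (y - c) / e by lra.
by rewrite ler_pdivlMr // mul1r; lra.
Qed.

Lemma sker_sum e c y : derive1 (derive1 (sker true e c)) y + sker false e c y
  = derive1 (derive1 (atom e c)) y.
Proof.
rewrite /sker; have sa := smooth_atom e c; have sl := smooth_cut_line c.
by rewrite derive1_smoothB // derive1_smoothB ?subrK //; exact: smooth_derive1.
Qed.

Lemma ker_bounds : exists2 M : R, 1 <= M &
  forall b e x y, 0 < e <= 4^-1 -> 0 <= x <= 1 -> 0 <= y <= 1 ->
    [/\ `|ker b x y| <= M, `|sker b e (center e x) y| <= M &
        `|sker b e (center e x) y - ker b x y| <= M * e].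
Proof.
have [A1 h1] := smooth_bounded (smooth_derive1 smooth_cutoff).
have [A2 h2] := smooth_bounded (smooth_derive1 (smooth_derive1 smooth_cutoff)).
have i0 : 0 <= (0 : R) <= 1 by rewrite lexx ler01.
have A10 : 0 <= A1 := le_trans (normr_ge0 _) (h1 0 i0).
have A20 : 0 <= A2 := le_trans (normr_ge0 _) (h2 0 i0).
(* Room for the kernel bound 2 + 2 * A1 + A2 together with the distance 5 + 2 * A2. *)
pose M := 8 + 2 * A1 + 4 * A2; exists M; first by rewrite /M; lra.
move=> b e x y he hx hy; have /andP[e0 e1] := he; have [_ _ c3] := center_dist he hx.
set c := center e x in c3 *.
have hk : `|ker b x y| <= 2 + 2 * A1 + A2.
  case: b => /=.
    have /andP[s0 s1] := step_itv (2 * y - 2^-1); rewrite -/(cutoff y) in s0 s1.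
    have m1 : `|Num.max (y - x) 0| <= 1 by rewrite ger0_norm ?le_max ?lexx ?orbT // ge_max; lra.
    have m2 : `|(y - x) * cutoff y| <= 1.
      rewrite normrM -[leRHS]mulr1; apply: ler_pM => //; first by rewrite ler_norml; lra.
      by rewrite ger0_norm.
    by have := ler_normB (Num.max (y - x) 0) ((y - x) * cutoff y); lra.
  have m1 : `|2 * derive1 cutoff y| <= 2 * A1.
    by rewrite normrM ger0_norm // ler_wpM2l // h1.
  have m2 : `|(y - x) * derive1 (derive1 cutoff) y| <= 1 * A2.
    by rewrite normrM; apply: ler_pM => //; [rewrite ler_norml; lra|exact: h2].
  by have := ler_normD (2 * derive1 cutoff y) ((y - x) * derive1 (derive1 cutoff) y); lra.
(* The 5 is 1 for smoothing the kink, 2 for the shift of the centre in the positive part and 2 for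
   the shift in the cut line. *)
have hd : `|sker b e c y - ker b x y| <= (5 + 2 * A2) * e.
  case: b {hk} => /=; last first.
    rewrite cut_line''; have -> : 2 * derive1 cutoff y + (y - c) * derive1 (derive1 cutoff) y -
      (2 * derive1 cutoff y + (y - x) * derive1 (derive1 cutoff) y) =
      - ((c - x) * derive1 (derive1 cutoff) y) by ring.
    rewrite normrN normrM; apply: (@le_trans _ _ (2 * e * A2)); first by apply: ler_pM => //; exact: h2.
    by rewrite mulrDl; have := mulr_ge0 A20 (ltW e0); lra.
  have a1 : `|atom e c y - Num.max (y - c) 0| <= e.
    have -> : Num.max (y - c) 0 = e * Num.max ((y - c) / e) 0.
      by rewrite maxr_pMr ?(ltW e0) // mulr0 mulrCA divff ?mulr1 // gt_eqF.
    rewrite /atom -mulrBr normrM ger0_norm ?(ltW e0) // -[leRHS]mulr1.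
    by apply: ler_wpM2l; [exact: ltW|exact: ramp_dist].
  have a2 : `|Num.max (y - c) 0 - Num.max (y - x) 0| <= 2 * e.
    move: c3; rewrite !ler_norml.
    by case: (leP (y - c) 0); case: (leP (y - x) 0); lra.
  have a3 : `|(c - x) * cutoff y| <= 2 * e.
    have /andP[s0 s1] := step_itv (2 * y - 2^-1); rewrite -/(cutoff y) in s0 s1.
    by rewrite normrM -[leRHS]mulr1; apply: ler_pM => //; rewrite ger0_norm.
  have -> : atom e c y - cut_line c y - (Num.max (y - x) 0 - (y - x) * cutoff y) =
    (atom e c y - Num.max (y - c) 0) + (Num.max (y - c) 0 - Num.max (y - x) 0)
     + (c - x) * cutoff y by rewrite /cut_line; ring.
  have := ler_normD (atom e c y - Num.max (y - c) 0 + (Num.max (y - c) 0 - Num.max (y - x) 0)) ((c - x) * cutoff y).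
  have := ler_normD (atom e c y - Num.max (y - c) 0) (Num.max (y - c) 0 - Num.max (y - x) 0).
  have -> : (5 + 2 * A2) * e = 5 * e + 2 * (A2 * e) by ring.
  by have := mulr_ge0 A20 (ltW e0); lra.
have p1 := mulr_ge0 A10 (ltW e0); have p2 := mulr_ge0 A20 (ltW e0).
split; first by rewrite /M; lra.
  have -> : sker b e c y = (sker b e c y - ker b x y) + ker b x y by ring.
  have := ler_normD (sker b e c y - ker b x y) (ker b x y).
  have : (5 + 2 * A2) * e <= 5 + 2 * A2 by rewrite -[leRHS]mulr1 ler_wpM2l; lra.
  by rewrite /M; lra.
by apply: (le_trans hd); rewrite ler_wpM2r ?(ltW e0) // /M; lra.
Qed.

(** With v = 2u - 1 and y >= 0, (y - |v|)_+ = (|v - y| + |v + y|) / 2 - |v|, whence the values 1, 1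
    + y and 1 - y of [c]. In [ker false] only |v| occurs. *)
Lemma tent_kernel_ker : exists A : R, forall b y, 0 <= y <= 1 ->
  tent_kernel A (fun u => ker b (tent u) y).
Proof.
have [A1 h1] := smooth_bounded (smooth_derive1 smooth_cutoff).
have [A2 h2] := smooth_bounded (smooth_derive1 (smooth_derive1 smooth_cutoff)).
have i0 : 0 <= (0 : R) <= 1 by rewrite lexx ler01.
have A10 : 0 <= A1 := le_trans (normr_ge0 _) (h1 0 i0).
have A20 : 0 <= A2 := le_trans (normr_ge0 _) (h2 0 i0).
exists (2 + 2 * A1 + A2) => b y hy.
pose c (j : 'I_3) : R := nth 0 [:: 1; 1 + y; 1 - y] j.
pose a (j : 'I_4) : R := nth 0 (if b then [:: - (y * cutoff y); cutoff y - 1; 2^-1; 2^-1]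
  else [:: 2 * derive1 cutoff y + y * derive1 (derive1 cutoff) y; - derive1 (derive1 cutoff) y; 0; 0]) j.
have /andP[s0 s1] := step_itv (2 * y - 2^-1); rewrite -/(cutoff y) in s0 s1.
exists a, c; split.
- have k1 := h1 y hy; have k2 := h2 y hy.
  have k3 : `|y * derive1 (derive1 cutoff) y| <= 1 * A2.
    by rewrite normrM ler_pM // ler_norml; lra.
  have k4 : `|y * cutoff y| <= 1 * 1 by rewrite normrM ler_pM // ler_norml; lra.
  have k5 : `|2 * derive1 cutoff y| <= 2 * A1 by rewrite normrM ger0_norm // ler_wpM2l.
  have k6 := ler_normD (2 * derive1 cutoff y) (y * derive1 (derive1 cutoff) y).
  rewrite /a; case: b {a} => -[[|[|[|[|//]]]] j] /=; rewrite ?normrN ?normr0; try lra;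
    by rewrite ler_norml; lra.
- by move=> [[|[|[|//]]] j]; rewrite /c /=; lra.
apply/funext => u; rewrite !big_ord_recl big_ord0 /c /a /= /tent.
case: b {a} => /=; last by ring.
have -> : 2 * u - (1 + y) = 2 * u - 1 - y by ring.
have -> : 2 * u - (1 - y) = 2 * u - 1 + y by ring.
move: (2 * u - 1) => v; suff -> : Num.max (y - `|v|) 0 = 2^-1 * (`|v - y| + `|v + y|) - `|v| by ring.
by case: (ger0P v); case: (ger0P (v - y)); case: (ger0P (v + y)); case: (leP (y - _) 0); lra.
Qed.

End Atoms.

(** * Point functionals on the unit ball *)

Section PointFunctional.
Variables (R : realType) (d : nat).
Local Notation cube := (@unit_cube R d).

Lemma card_set_ord : #|{: {set 'I_d}}| = (2 ^ d)%N.
Proof. by rewrite -cardsT -powersetT card_powerset cardsT card_ord. Qed.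

Lemma ucont_mul_tsum (f : 'rV[R]_d -> R) N (a : 'I_N -> R) (phi : 'I_N -> 'I_d -> R -> R) :
  {within cube, continuous f}%classic -> (forall q i, continuous (phi q i)) ->
  ucont (fun y => f y * tsum a phi y).
Proof.
move=> cf cphi; apply: within_continuous_ucont => y; apply: continuousM; first exact: cf.
exact: (continuous_subspaceT (continuous_tsum cphi)).
Qed.

Lemma point_functional_ord_le (f : 'rV[R]_d -> R) N (a : 'I_N -> R) (x : 'I_N -> 'rV[R]_d) (B : R) :
  H2mix_unit_ball f -> (forall q, cube (x q)) ->
  (forall (E : {set 'I_d}) y, cube y ->
     `|\sum_q a q * \prod_i ker (i \in E) (x q ord0 i) (y ord0 i)| <= B) ->
  `|\sum_q a q * f (x q)| <= 2 ^+ d * B.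
Proof.
move=> [cf [g [mg [weak norm1]]]] cx hB.
have B0 : 0 <= B := le_trans (normr_ge0 _) (hB finset.set0 0 (@cube0 R d)).
have [M M1 hM] := ker_bounds R.
have [A hA] := smooth_bounded (smooth_derive1 (smooth_derive1 (smooth_ramp R))).
have A0 : 0 <= A by have := hA 0; rewrite lexx ler01 => /(_ isT); apply: le_trans.
pose sa := \sum_q `|a q|; have sa0 : 0 <= sa by apply: sumr_ge0.
have ac0 k : 0 <= approx_cst A k.
  by elim: k => //= k IH; rewrite addr_ge0 // mulr_ge0 // addr_ge0 // mulr_ge0.
apply/ler_addgt0Pr => eta eta0.
pose P := sa * approx_cst A d; have P0 : 0 <= P by rewrite mulr_ge0.
(* Half of [eta] pays for replacing point values of [f] by integrals against the atoms. *)
pose omega := eta / 2 / (P + 1).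
have o0 : 0 < omega by rewrite !divr_gt0 // ltr_wpDl.
have Po : P * omega <= eta / 2.
  by rewrite /omega mulrCA ger_pMr ?divr_gt0 // ler_pdivrMr ?ltr_wpDl // mul1r lerDl.
have [delta d0 md] := within_continuous_ucont cf o0.
pose c1 := sa * (d%:R * M ^+ d).
have c10 : 0 <= c1 by rewrite !mulr_ge0 // exprn_ge0 // (le_trans ler01).
pose L := 2 ^+ d * c1; have L0 : 0 <= L by rewrite mulr_ge0 // exprn_ge0.
(* 1/4 keeps the supports inside the cube, [delta / 3] fits the radius [3 * e] of
   [approx_eval_atom], and the last term makes passing from [sker] to [ker] cost at most the other
   half of [eta]. *)
pose e := Num.min 4^-1 (Num.min (delta / 3) (eta / 2 / (L + 1))).
have e0 : 0 < e by rewrite !lt_min invr_gt0 ltr0n /= !divr_gt0 // ltr_wpDl.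
have e4 : e <= 4^-1 by rewrite ge_min lexx.
have he : 0 < e <= 4^-1 by rewrite e0.
have e3 : 3 * e <= delta by rewrite mulrC -ler_pdivlMr // !ge_min lexx orbT.
have eL : L * e <= eta / 2.
  have h : e <= eta / 2 / (L + 1) by rewrite !ge_min lexx !orbT.
  apply: (le_trans (ler_wpM2l L0 h)).
  by rewrite mulrCA ger_pMr ?divr_gt0 // ler_pdivrMr ?ltr_wpDl // mul1r lerDl.
have m3 : modulus f (3 * e) omega.
  by move=> y z cy cz yz; apply: md => // i; apply: le_trans (yz i) e3.
pose phi (E : {set 'I_d}) (q : 'I_N) (i : 'I_d) := sker (i \in E) e (center e (x q ord0 i)).
have sphi E q i : smooth (phi E q i) by exact: smooth_sker.
have tphi E : test_function (tsum a (phi E)).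
  apply: (@test_function_tsum _ _ _ _ _ e) => // q i u hu.
  by apply: sker_supp => //; exact: cx.
have g2 E : (cube_integral (fun y => (g E y ^+ 2)%:E) <= 1)%E.
  apply: le_trans norm1; rewrite (bigD1 E) //= leeDl // sume_ge0 // => E' _.
  by apply: iint_rec_ge0 => y; rewrite lee_fin sqr_ge0.
have bphi E y : cube y -> `|tsum a (phi E) y| <= B + c1 * e.
  move=> cy; pose K := \sum_q a q * \prod_i ker (i \in E) (x q ord0 i) (y ord0 i).
  suff h : `|tsum a (phi E) y - K| <= c1 * e.
    have := ler_normD (tsum a (phi E) y - K) K; rewrite subrK.
    by have := hB E y cy; rewrite -/K; lra.
  rewrite /tsum /K -sumrB; apply: (le_trans (ler_norm_sum _ _ _)).
  rewrite /c1 /sa !mulr_suml; apply: ler_sum => q _.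
  rewrite -mulrBr normrM -!mulrA; apply: ler_wpM2l => //.
  have := @prod_dist R 'I_d (fun i => phi E q i (y ord0 i))
    (fun i => ker (i \in E) (x q ord0 i) (y ord0 i)) M e (ltW e0).
  rewrite card_ord mulrA; apply=> i;
    by have [] := hM (i \in E) e (x q ord0 i) (y ord0 i) he (cx q i) (cy i).
have cphi (E : {set 'I_d}) : forall q i, continuous (fun u => if i \in E then derive1 (derive1 (phi E q i)) u else phi E q i u).
  move=> q i; case: (i \in E); apply: smooth_continuous => //.
  by do 2 apply: smooth_derive1.
pose psi (E : {set 'I_d}) (q : 'I_N) i u := if i \in E then derive1 (derive1 (phi E q i)) u else phi E q i u.
have mix E : mixed2 E (tsum a (phi E)) = tsum a (psi E).
  rewrite mixed2_tsum //; congr tsum; apply/funext => q; apply/funext => i; rewrite /psi.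
  by case: ifP.
have uf E : ucont (fun y => f y * tsum a (psi E) y) by apply: ucont_mul_tsum => //; exact: cphi.
(* The weak derivative enters here: the integral of [f] against the mixed derivative is that of
   [g E] against the test function itself, bounded by its supremum. *)
have pair E : `|riint (enum 'I_d) (fun y => f y * tsum a (psi E) y) 0| <= B + c1 * e.
  have := weak E _ (tphi E); rewrite mix /cube_integral EFin_riint //; last exact: cube0.
  move=> h; rewrite -lee_fin -abse_EFin h.
  by apply: cube_integral_pairing_le => //; [exact: bphi|rewrite addr_ge0 // mulr_ge0 // ltW].
pose W (q : 'I_N) (i : 'I_d) := derive1 (derive1 (atom e (center e (x q ord0 i)))).
have cW q i : continuous (W q i).
  by apply: smooth_continuous; do 2 apply: smooth_derive1; exact: smooth_atom.
pose T q := riint (enum 'I_d) (fun y => f y * \prod_(i <- enum 'I_d) W q i (y ord0 i)) 0.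
have uT q : ucont (fun y => f y * \prod_(i <- enum 'I_d) W q i (y ord0 i)).
  apply: within_continuous_ucont => y; apply: continuousM; first exact: cf.
  apply: continuous_subspaceT; apply: continuous_bigprod => i z.
  by apply: continuous_comp; [exact: coord_continuous|exact: cW].
have sumT : \sum_q a q * T q = \sum_E riint (enum 'I_d) (fun y => f y * tsum a (psi E) y) 0.
  transitivity (riint (enum 'I_d) (fun y => \sum_q a q * (f y * \prod_(i <- enum 'I_d) W q i (y ord0 i))) 0).
    rewrite riint_sum; [|move=> q|exact: cube0]; last first.
      rewrite (_ : (fun y => _) = (fun y => f y * tsum (fun=> a q) (fun (_ : 'I_1) => W q) y)).
        by apply: ucont_mul_tsum.
      apply/funext => y; rewrite /tsum big_ord1 mulrCA; congr (_ * (_ * _)).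
      by rewrite big_enum.
    by apply: eq_bigr => q _; rewrite /T riintZ //; exact: cube0.
  rewrite -riint_sum //; last exact: cube0.
  apply: eq_riint => [|y cy]; first exact: cube0.
  rewrite -mulr_sumr /tsum exchange_big /= mulr_sumr; apply: eq_bigr => q _.
  rewrite -mulr_sumr mulrCA; congr (_ * (_ * _)); rewrite big_enum /=.
  rewrite (eq_bigr (fun i => derive1 (derive1 (sker true e (center e (x q ord0 i)))) (y ord0 i)
     + sker false e (center e (x q ord0 i)) (y ord0 i))) => [|i _]; last by rewrite sker_sum.
  (* The product of two-term sums expands into one term for each [E], the set of coordinates where
     the differentiated kernel is chosen. *)
  rewrite bigA_distr; apply: eq_bigr => E _; apply: eq_bigr => i _.
  by rewrite /psi /phi; case: ifP.
have apx q : `|T q - f (x q)| <= approx_cst A d * omega.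
  have := @riint_approx_eval R d (enum 'I_d) f (W q) (fun i => x q ord0 i) (3 * e) omega A 0.
  rewrite size_enum_ord; have -> : set_all (enum 'I_d) (fun i => x q ord0 i) 0 = x q.
    by apply/rowP => i; rewrite set_allE mem_enum.
  apply=> //.
  - exact: cx.
  - exact: ltW.
  - by rewrite mulr_ge0 // ltW.
  - by move=> i; apply: approx_eval_atom => //; exact: cx.
  - exact: enum_uniq.
  - exact: cube0.
have -> : \sum_q a q * f (x q) = \sum_q a q * T q - \sum_q a q * (T q - f (x q)).
  by rewrite -sumrB; apply: eq_bigr => q _; rewrite mulrBr subKr.
apply: (le_trans (ler_normB _ _)).
have b1 : `|\sum_q a q * (T q - f (x q))| <= P * omega.
  apply: (le_trans (ler_norm_sum _ _ _)); rewrite /P /sa -mulrA mulr_suml.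
  by apply: ler_sum => q _; rewrite normrM ler_wpM2l.
have b2 : `|\sum_q a q * T q| <= 2 ^+ d * B + L * e.
  rewrite sumT; apply: (le_trans (ler_norm_sum _ _ _)).
  apply: (le_trans (ler_sum _ (fun E _ => pair E))).
  by rewrite sumr_const card_set_ord -[_ *+ (2 ^ d)%N]mulr_natl natrX mulrDr /L mulrA.
by move: b1 b2 Po eL; lra.
Qed.

Lemma point_functional_le (f : 'rV[R]_d -> R) (Q : seq (R * 'rV[R]_d)) (B : R) :
  H2mix_unit_ball f -> all (fun q : R * 'rV[R]_d => [forall i, 0 <= q.2 ord0 i <= 1]) Q ->
  (forall (E : {set 'I_d}) y, cube y ->
     `|\sum_(q <- Q) q.1 * \prod_i ker (i \in E) (q.2 ord0 i) (y ord0 i)| <= B) ->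
  `|\sum_(q <- Q) q.1 * f q.2| <= 2 ^+ d * B.
Proof.
move=> bf /(all_nthP (0, 0)) cQ hB; rewrite (big_nth (0, 0)) big_mkord.
apply: (@point_functional_ord_le f (size Q) (fun q => (nth (0, 0) Q q).1)
  (fun q => (nth (0, 0) Q q).2)) => // [q i|E y cy].
  by move: (cQ q (ltn_ord q)) => /forallP /(_ i).
by have := hB E y cy; rewrite (big_nth (0, 0)) big_mkord.
Qed.

(** The tent transformed product grid as a weighted list, built like [imean] and ready to be joined
    to the net by concatenation. *)
Fixpoint grid m (s : seq 'I_d) (x : 'rV[R]_d) : seq (R * 'rV[R]_d) :=
  if s is i :: s' then
    flatten [seq [seq (2^-1 ^+ m * q.1, q.2) | q <- grid m s' (set_coord x i (tent (dyadic R b)))]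
            | b <- enum {: 'cV['F_2]_m}]
  else [:: (1, x)].

Lemma imean_grid m s F x : \sum_(q <- grid m s x) q.1 * F q.2 = imean m s F x.
Proof.
elim: s x => [|i s IH] x /=; first by rewrite big_seq1 mul1r.
rewrite big_flatten /= big_map big_enum /= /dmean mulr_sumr; apply: eq_bigr => b _.
rewrite big_map /= -IH mulr_sumr; apply: eq_bigr => q _.
by rewrite mulrA.
Qed.

Lemma grid_cube m s x : cube x -> all (fun q : R * 'rV[R]_d => [forall i, 0 <= q.2 ord0 i <= 1]) (grid m s x).
Proof.
elim: s x => [|i s IH] x cx /=; first by rewrite andbT; apply/forallP => i; exact: cx.
apply/allP => _ /flattenP[_ /mapP[b _ ->] /mapP[q qin ->]] /=.
apply: (allP (IH _ _) q qin); apply: cube_set_coord => //.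
by apply: tent_itv; exact: dyadic_itv.
Qed.

Lemma dmeanZr m (g : R -> R) c : dmean m (fun u => g u * c) = dmean m g * c.
Proof. by rewrite /dmean -mulr_suml mulrA. Qed.

Lemma imean_prod m s (h : 'I_d -> R -> R) x : uniq s ->
  imean m s (fun y => \prod_i h i (y ord0 i)) x
    = \prod_i (if i \in s then dmean m (fun u => h i (tent u)) else h i (x ord0 i)).
Proof.
elim: s x => [|i s IH] x //= /andP[nis us].
transitivity (dmean m (fun u => h i (tent u) *
    \prod_(j | j != i) (if j \in s then dmean m (fun u => h j (tent u)) else h j (x ord0 j)))); last first.
  rewrite dmeanZr [RHS](bigD1 i) //= mem_head; congr (_ * _).
  by apply: eq_bigr => j ji; rewrite in_cons (negbTE ji).
apply: eq_dmean => u _; rewrite IH // (bigD1 i) //= (negbTE nis) mxE eqxx; congr (_ * _).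
by apply: eq_bigr => j ji; rewrite mxE (negbTE ji).
Qed.

End PointFunctional.

(** * The error bound *)

Lemma pow_half_small (R : realType) (delta : R) : 0 < delta ->
  exists k : nat, forall m, (k <= m)%N -> 2^-1 ^+ m <= delta.
Proof.
move=> d0; pose k := Num.truncn delta^-1; exists k.+1 => m km.
have h : delta^-1 < k.+1%:R by apply: truncnS_gt.
rewrite exprVn -[delta]invrK lef_pV2 ?posrE ?invr_gt0 ?exprn_gt0 //.
apply: ltW; apply: lt_le_trans h _; rewrite -natrX ler_nat.
by apply: leq_trans km (ltnW (ltn_expl _ _)).
Qed.

Theorem theorem5p2 (R : realType) (d : nat) (d_gt0 : (0 < d)%N) :
  exists2 K : R, 0 < K &
    forall (t n : nat) (C : 'I_d -> 'M['F_2]_(2 * n, n)),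
      (0 < n)%N ->
      order2_digital_net t C ->
      (eQMC (tent_net_point R C) <=
         (K * 2 ^+ t * ((2 ^ n)%:R ^+ 2)^-1 * ln ((2 ^ n)%:R) ^+ (2 * d - 1))%:E)%E.
Proof.
have [A hA] := tent_kernel_ker R.
have A0 : 0 <= A.
  have [|a [c [ha _ _]]] := hA true 0; first by rewrite lexx ler01.
  exact: le_trans (normr_ge0 _) (ha ord0).
have ln2 : 0 < ln 2 :> R by rewrite ln_gt0 // ltr1n.
pose c0 := (d + 4)%:R * (13 * A) ^+ d.
have c00 : 0 <= c0 by rewrite mulr_ge0 // exprn_ge0 // mulr_ge0.
(* 2^d comes from the point functional, [c0] from net against grid, and [3 / ln 2] from replacing
   [2 * n + 1] by log N. The 1 added to [K0] below ensures positivity. *)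
pose K0 := 2 ^+ d * c0 * (3 / ln 2) ^+ (2 * d - 1).
have K00 : 0 <= K0.
  apply: mulr_ge0; first by rewrite mulr_ge0 // exprn_ge0.
  by rewrite exprn_ge0 // divr_ge0 // ltW.
exists (1 + K0); first by rewrite ltr_pwDl.
move=> t n C n0 netC; apply: ge_ereal_sup => _ [f bf <-].
pose X := 2 ^+ t * 2^-1 ^+ (2 * n) * (2 * n).+1%:R ^+ (2 * d - 1) : R.
have X0 : 0 <= X by rewrite !mulr_ge0 // exprn_ge0 // invr_ge0.
have main : `|(2 ^ n)%:R^-1 * \sum_(k < 2 ^ n) f (tent_net_point R C k)
    - riint (enum 'I_d) f 0| <= 2 ^+ d * (c0 * X).
  apply/ler_addgt0Pr => eta eta0.
  have [cf _] := bf; have uf := within_continuous_ucont cf.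
  have eta1 : 0 < eta / (d.+1)%:R by rewrite divr_gt0.
  have [delta dl0 md] := uf _ eta1.
  (* [k] makes the grid finer than the modulus of [f] requires, [2 * n] at least as fine as the
     net. *)
  have [k hk] := pow_half_small dl0; pose m := (k + 2 * n)%N.
  have mm : modulus f (2^-1 ^+ m) (eta / (d.+1)%:R).
    move=> y z cy cz yz; apply: md => // i; apply: le_trans (yz i) (hk _ _).
    exact: leq_addr.
  have im := imean_dist (enum 'I_d) uf mm (@cube0 R d).
  pose Q := [seq ((2 ^ n)%:R^-1, tent_net_point R C k) | k <- index_enum 'I_(2 ^ n)]
    ++ [seq (- q.1, q.2) | q <- grid m.+1 (enum 'I_d) (0 : 'rV[R]_d)].
  have QE F : \sum_(q <- Q) q.1 * F q.2 =
      (2 ^ n)%:R^-1 * \sum_(k < 2 ^ n) F (tent_net_point R C k) - imean m.+1 (enum 'I_d) F 0.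
    rewrite big_cat !big_map /= -mulr_sumr; congr (_ + _).
    by rewrite -imean_grid -sumrN; apply: eq_bigr => q _; rewrite mulNr.
  have cQ : all (fun q : R * 'rV[R]_d => [forall i, 0 <= q.2 ord0 i <= 1]) Q.
    rewrite all_cat !all_map; apply/andP; split.
      apply/allP => j _ /=; apply/forallP => i; rewrite mxE.
      by apply: tent_itv; apply: dyadic_itv.
    by have := grid_cube m.+1 (enum 'I_d) (@cube0 R d).
  have hQ (E : {set 'I_d}) y : unit_cube y ->
      `|\sum_(q <- Q) q.1 * \prod_i ker (i \in E) (q.2 ord0 i) (y ord0 i)| <= c0 * X.
    move=> cy; rewrite (QE (fun z => \prod_i ker (i \in E) (z ord0 i) (y ord0 i))).
    rewrite (imean_prod _ (fun i u => ker (i \in E) u (y ord0 i))) ?enum_uniq //.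
    have := @net_grid_dist R d t n m.+1 C A (fun i u => ker (i \in E) (tent u) (y ord0 i))
      d_gt0 n0 netC (leq_trans (leq_addl _ _) (leqnSn _)) (fun i => hA _ _ (cy i)).
    congr (`|_ - _| <= _).
      by congr (_ * _); apply: eq_bigr => j _; apply: eq_bigr => i _; rewrite mxE.
    by apply: eq_bigr => i _; rewrite mem_enum.
  have := point_functional_le bf cQ hQ; rewrite QE size_enum_ord in im * => pf.
  rewrite -(subrKA (imean m.+1 (enum 'I_d) f 0)); apply: (le_trans (ler_normD _ _)).
  apply: lerD => //; apply: (le_trans im); rewrite mulrCA ger_pMr //.
  by rewrite ler_pdivrMr ?ltr0n // mul1r ler_nat.
have [cf _] := bf; rewrite /cube_integral (EFin_riint _ (within_continuous_ucont cf) (@cube0 R d)).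
rewrite -EFinB abse_EFin lee_fin; apply: (le_trans main).
have e1 : ((2 ^ n)%:R ^+ 2)^-1 = 2^-1 ^+ (2 * n) :> R.
  by rewrite natrX -exprM mulnC exprVn.
have e2 : ln (2 ^ n)%:R = n%:R * ln 2 :> R by rewrite natrX lnXn // mulr_natl.
rewrite e1 e2.
have h3 : (2 * n).+1%:R ^+ (2 * d - 1) <= (3 / ln 2) ^+ (2 * d - 1) * (n%:R * ln 2) ^+ (2 * d - 1) :> R.
  rewrite -exprMn; apply: lerXn2r; rewrite ?nnegrE //.
    by rewrite !mulr_ge0 // ?invr_ge0 // ltW.
  (* As n >= 1, 2n + 1 <= 3n. *)
  have -> : 3 / ln 2 * (n%:R * ln 2) = 3 * n%:R :> R by field; rewrite gt_eqF.
  by rewrite -natrM ler_nat; lia.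
have y0 : 0 <= 2 ^+ t * 2^-1 ^+ (2 * n) :> R by rewrite mulr_ge0 // exprn_ge0 // invr_ge0.
have z0 : 0 <= (n%:R * ln 2) ^+ (2 * d - 1) :> R by rewrite exprn_ge0 // mulr_ge0 // ltW.
apply: (@le_trans _ _ (K0 * (2 ^+ t * 2^-1 ^+ (2 * n)) * (n%:R * ln 2) ^+ (2 * d - 1))).
  have -> : K0 * (2 ^+ t * 2^-1 ^+ (2 * n)) * (n%:R * ln 2) ^+ (2 * d - 1) =
    2 ^+ d * (c0 * (2 ^+ t * 2^-1 ^+ (2 * n) * ((3 / ln 2) ^+ (2 * d - 1) * (n%:R * ln 2) ^+ (2 * d - 1)))).
    by rewrite /K0; ring.
  by rewrite !ler_wpM2l // exprn_ge0.
rewrite -[(1 + K0) * _ * _]mulrA; apply: ler_wpM2r => //; apply: ler_wpM2r => //.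
by rewrite lerDr.
Qed.
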